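(* For every topological group $G$ there exists a complete $\omega$-homogeneous Urysohn metric space $M$ of the same weight as $G$ such that $G$ is isomorphic, as a topological group, to a subgroup of $\mathrm{Iso}(M)$.
   Context: All topological groups are assumed to be Hausdorff. For a metric space $M$, $\mathrm{Iso}(M)$ denotes the topological group of all isometries of $M$ onto itself with the topology of pointwise convergence; subgroups carry the subspace topology. A metric space $M$ is $\omega$-homogeneous if every isometry (distance-preserving bijection) $f:A\to B$ between finite subsets $A,B$ of $M$ extends to an isometry of $M$ onto itself. A metric space $M$ is Urysohn if its diameter equals $1$ and for every finite metric space $L$ of diameter $\le1$, every $K\subset L$ and every isometric embedding $f:K\to M$, $f$ extends to an isometric embedding of $L$ into $M$. The weight of a topological space $X$ is the cardinal $w(X)=\min\{|\mathcal B|:\mathcal B\text{ is a base for }X\}$.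
   Formalization: For finite G the weight of G is the finite number |G|, while every Urysohn space has infinite weight, so equality of weights is impossible there; the formal theorem asserts w(M)=w(G) for infinite G and w(M)=ℵ₀ for finite G. *)

(* Defs.v *)
From HB Require Import structures.
From mathcomp Require Import all_boot all_order all_algebra.
From mathcomp Require Import all_classical all_reals all_analysis.

Set Implicit Arguments.
Unset Strict Implicit.
Unset Printing Implicit Defensive.

Import Order.TTheory GRing.Theory Num.Theory.
Local Open Scope classical_set_scope.
Local Open Scope ring_scope.
Local Open Scope card_scope.

(* Separation is not part of the structure: the Hausdorff axiom is stated
   separately, with hausdorff_space. *)
HB.mixin Record Group_isTopologicalGroup G & Topological G & Group G := {
  mulg_continuous : continuous (fun p : G * G => (p.1 * p.2)%g) ;
  invg_continuous : continuous (fun x : G => (x^-1)%g)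
}.

#[short(type="topologicalGroupType")]
HB.structure Definition TopologicalGroup :=
  { G of Topological G & Group G & Group_isTopologicalGroup G }.

Definition topgroup_isomorphic (G H : topologicalGroupType) : Prop :=
  exists (f : G -> H) (g : H -> G),
    [/\ cancel f g, cancel g f, {morph f : x y / (x * y)%g},
        continuous f & continuous g].

(* Carrier of a subgroup S, with the group structure and the subspace topology
   inherited from G. *)
Definition subgroup (G : topologicalGroupType) (S : groupClosed G) : Type :=
  {x : G | x \in S}.

Section Subgroup.
Context {G : topologicalGroupType} (S : groupClosed G).
Local Notation H := (subgroup S).

HB.instance Definition _ := SubChoice.on H.

Let subgroup_closed : group_closed (fun x : G => x \in S).
Proof. by split; [exact: gpred1 | exact: gpredF]. Qed.

HB.instance Definition _ :=
  SubChoice_isSubGroup.Build G _ H subgroup_closed.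
HB.instance Definition _ :=
  Topological.copy H (initial_topology (val : H -> G)).

Let subgroup_valC : continuous (val : H -> G).
Proof. exact: initial_continuous. Qed.

Let subgroup_mulC : continuous (fun p : H * H => (p.1 * p.2)%g).
Proof.
apply: (@continuous_comp_initial _ _ _ (val : H -> G)) => p.
apply: (@continuous_comp _ _ _ (fun p : H * H => (val p.1, val p.2))
  (fun q : G * G => (q.1 * q.2)%g)); last exact: mulg_continuous.
by apply: cvg_pair => /=; apply: continuous_comp => //;
  [exact: cvg_fst | exact: subgroup_valC | exact: cvg_snd
  | exact: subgroup_valC].
Qed.

Let subgroup_invC : continuous (fun x : H => (x^-1)%g).
Proof.
apply: (@continuous_comp_initial _ _ _ (val : H -> G)) => x.
apply: (@continuous_comp _ _ _ (val : H -> G) (fun y : G => (y^-1)%g)).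
  exact: subgroup_valC.
exact: invg_continuous.
Qed.

HB.instance Definition _ :=
  Group_isTopologicalGroup.Build H subgroup_mulC subgroup_invC.

End Subgroup.

Section Metric.
Context {R : realType}.

Definition isometric_on (X Y : metricType R) (A : set X) (f : X -> Y) : Prop :=
  forall x y, A x -> A y -> mdist (f x) (f y) = mdist x y.

Record Iso (M : metricType R) : Type := MkIso {
  Iso_fun :> M -> M ;
  Iso_isometric : isometric_on [set: M] Iso_fun ;
  Iso_surjective : forall y, exists x, Iso_fun x = y
}.

Section IsoGroup.
Context {M : metricType R}.
Implicit Types f g : Iso M.

Lemma IsoP f g : (forall x, f x = g x) -> f = g.
Proof.
case: f g => [f f1 f2] [g g1 g2] /= /funext fg; rewrite -{}fg in g1 g2 *.
by congr MkIso; exact: Prop_irrelevance.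
Qed.

HB.instance Definition _ := gen_eqMixin (Iso M).
HB.instance Definition _ := gen_choiceMixin (Iso M).
HB.instance Definition _ := Topological.copy (Iso M)
  (initial_topology (@Iso_fun M : Iso M -> {ptws M -> M})).

Lemma Iso_inj f : injective f.
Proof.
move=> x y fxy; apply: mdist_positivity.
by rewrite -(Iso_isometric f)// fxy mdistxx.
Qed.

Definition Iso_one : Iso M :=
  @MkIso M id (fun _ _ _ _ => erefl) (fun y => ex_intro _ y erefl).

Fact Iso_mul_isometric f g : isometric_on [set: M] (f \o g).
Proof. by move=> x y _ _ /=; rewrite !Iso_isometric. Qed.

Fact Iso_mul_surjective f g y : exists x, (f \o g) x = y.
Proof.
have [z <-] := Iso_surjective f y; have [x <-] := Iso_surjective g z.
by exists x.
Qed.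

Definition Iso_mul f g : Iso M :=
  MkIso (Iso_mul_isometric f g) (Iso_mul_surjective f g).

Definition Iso_inv_fun f (y : M) : M := projT1 (cid (Iso_surjective f y)).

Fact Iso_inv_funK f : cancel (Iso_inv_fun f) f.
Proof. by move=> y; rewrite /Iso_inv_fun; case: cid. Qed.

Fact Iso_funK f : cancel f (Iso_inv_fun f).
Proof. by move=> x; apply: (@Iso_inj f); rewrite Iso_inv_funK. Qed.

Fact Iso_inv_isometric f : isometric_on [set: M] (Iso_inv_fun f).
Proof. by move=> x y _ _; rewrite -(Iso_isometric f)// !Iso_inv_funK. Qed.

Fact Iso_inv_surjective f y : exists x, Iso_inv_fun f x = y.
Proof. by exists (f y); rewrite Iso_funK. Qed.

Definition Iso_inv f : Iso M :=
  MkIso (Iso_inv_isometric f) (Iso_inv_surjective f).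

Fact Iso_mulA : associative Iso_mul.
Proof. by move=> f g h; exact: IsoP. Qed.

Fact Iso_mul1 : left_id Iso_one Iso_mul.
Proof. by move=> f; exact: IsoP. Qed.

Fact Iso_mulr1 : right_id Iso_one Iso_mul.
Proof. by move=> f; exact: IsoP. Qed.

Fact Iso_mulV : left_inverse Iso_one Iso_inv Iso_mul.
Proof. by move=> f; apply: IsoP => x; exact: Iso_funK. Qed.

Fact Iso_mulrV : right_inverse Iso_one Iso_inv Iso_mul.
Proof. by move=> f; apply: IsoP => x; exact: Iso_inv_funK. Qed.

HB.instance Definition _ := isGroup.Build (Iso M)
  Iso_mulA Iso_mul1 Iso_mulr1 Iso_mulV Iso_mulrV.

Fact Iso_eval_continuous (x : M) : continuous (fun f : Iso M => f x).
Proof.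
move=> f; apply: (@continuous_comp _ _ _ (@Iso_fun M : Iso M -> {ptws M -> M})
  (fun h : {ptws M -> M} => h x)).
  exact: initial_continuous.
exact: (@proj_continuous M (fun=> M) x).
Qed.

Fact Iso_eval_near (f : Iso M) (x : M) (e : R) :
  0 < e -> nbhs f [set g : Iso M | mdist (f x) (g x) < e].
Proof.
by move=> e0; exact: ((@metricType_numDomainType.cvgrPdist_lt _ _ _ (nbhs f)
  (nbhs_filter f) _ _).1 (@Iso_eval_continuous x f) _ e0).
Qed.

Fact continuous_to_Iso (T : topologicalType) (F : T -> Iso M) :
  (forall x, continuous (fun t => F t x)) -> continuous F.
Proof.
move=> Fc; apply: (@continuous_comp_initial (Iso M) T {ptws M -> M}) => t.
by apply/pointwise_cvgP => x; exact: Fc.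
Qed.

Fact Iso_mul_continuous : continuous (fun p : Iso M * Iso M => (p.1 * p.2)%g).
Proof.
apply: continuous_to_Iso => x -[f g].
apply/metricType_numDomainType.cvgrPdist_lt => e e0 /=.
have e20 : 0 < e / 2 by rewrite divr_gt0.
exists ([set f' : Iso M | mdist (f (g x)) (f' (g x)) < e / 2],
        [set g' : Iso M | mdist (g x) (g' x) < e / 2]); first by split; exact: Iso_eval_near.
move=> [f' g'] /= [f'e g'e].
rewrite (le_lt_trans (metric_triangle _ (f' (g x)) _))//.
by rewrite [e]splitr ltrD ?Iso_isometric.
Qed.

Fact Iso_inv_continuous : continuous (fun f : Iso M => (f^-1)%g).
Proof.
apply: continuous_to_Iso => x f.
apply/(@metricType_numDomainType.cvgrPdist_lt _ _ _ (nbhs f) (nbhs_filter f)).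
move=> e e0 /=.
apply: filterS (Iso_eval_near f (Iso_inv_fun f x) e0) => f' /=.
by rewrite -[in X in _ -> X](Iso_isometric f')// !Iso_inv_funK metric_sym.
Qed.

HB.instance Definition _ := Group_isTopologicalGroup.Build (Iso M)
  Iso_mul_continuous Iso_inv_continuous.

End IsoGroup.

Definition diam (X : metricType R) : \bar R :=
  ereal_sup [set (mdist x y)%:E | x in [set: X] & y in [set: X]].

Definition complete_metric (M : metricType R) : Prop :=
  forall F : set_system M, ProperFilter F -> cauchy F -> exists l : M, F --> l.

(* A map defined on a subset is represented by a function on the whole space
   whose values outside the subset are irrelevant. *)
Definition omega_homogeneous (M : metricType R) : Prop :=
  forall (A B : set M) (f : M -> M),
    finite_set A -> finite_set B -> set_bij A B f -> isometric_on A f ->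
    exists g : Iso M, forall x, A x -> g x = f x.

Definition Urysohn_metric (M : metricType R) : Prop :=
  diam M = 1%E /\
  forall (L : metricType R) (K : set L) (f : L -> M),
    finite_set [set: L] -> (diam L <= 1)%E -> isometric_on K f ->
    exists g : L -> M,
      isometric_on [set: L] g /\ forall x, K x -> g x = f x.

End Metric.

(* w(X) = |K|: the least cardinality of a base of X, without the convention
   that rounds finite weights up to aleph_0. *)
Definition has_weight (X : topologicalType) (U : Type) (K : set U) : Prop :=
  (exists B : set (set X), basis B /\ B #= K) /\
  (forall B : set (set X), basis B -> K #<= B).

Definition same_weight (X Y : topologicalType) : Prop :=
  exists K : set (set X), has_weight X K /\ has_weight Y K.

(* Main.v *)
(* A bikat function on a pseudometric space [X] is the cross distance of an
   extension of the pseudometric to two copies of [X]; isometries [g] of [X]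
   correspond to the bikat functions [d (g x) y] that vanish somewhere on every
   row and every column. Given a family of bikat functions, the space of pairs
   [(x, f)], with [(x, f)] at distance [f x y] from [y], contains for every [f]
   the missing images of the points of [X]. Each [f] extends to it without
   increasing the distance between two bikat functions, and in particular the
   distance between [f] and the identity, so that in the limit of the iterated
   construction [f] becomes an isometry. Everything is functorial for
   isometries of [X], so a group acting on [X] acts on the limit, and continuity
   of the action survives because a bikat function given by finitely many links
   [a i -- b i] depends uniformly continuously on the [a i] and [b i].
   These finitely linked functions suffice. Links from a single point realise
   the one-point extensions required of a Urysohn space; links along a finite
   partial isometry extend it. In the completion such extensions are only
   approximate, but an isometry that corrects an error [e] can be chosen to move
   no point by more than [e], so successive corrections converge uniformly to an
   exact one, even though the space is not separable.
   The construction starts from [G * J], where [J] indexes a base of [G], with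
   one left-invariant continuous pseudometric for each basic neighbourhood
   of [1]. *)
Require Import Defs.
From HB Require Import structures.
From mathcomp Require Import all_boot all_order all_algebra.
From mathcomp Require Import all_classical all_reals all_analysis.
From mathcomp Require Import lra.

Set Implicit Arguments.
Unset Strict Implicit.
Unset Printing Implicit Defensive.

Import Order.TTheory GRing.Theory Num.Theory.
Local Open Scope classical_set_scope.
Local Open Scope ring_scope.
Local Open Scope card_scope.

(** * Cardinals *)

Section Cardinals.

Lemma card_le_fun T U (A : set T) (B : set U) (f : T -> U) :
  (forall x, A x -> B (f x)) ->
  (forall x y, A x -> A y -> f x = f y -> x = y) -> A #<= B.
Proof.
move=> fAB finj; have [|g] := (@injfunPex _ _ A B).2; last exact: inj_card_le g.
by exists f => // x y /set_mem Ax /set_mem Ay; exact: finj.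
Qed.

Lemma card_le_ex T U (u : U) (A : set T) (B : set U) : A #<= B ->
  exists f : T -> U, (forall x, A x -> B (f x)) /\
    (forall x y, A x -> A y -> f x = f y -> x = y).
Proof.
move=> /card_leP[f]; have [|g gAB ginj] := (@injfunPex _ _ A B).1.
  by squash (valLR u f).
by exists g; split=> [|x y Ax Ay]; [exact: gAB | apply: ginj; exact: mem_set].
Qed.

(* A maximal set of choice functions that are pairwise different everywhere on
   [F] must exhaust one of the sets of [F], which it then injects into all the
   others. *)
Lemma card_le_min U (F : set (set U)) :
  F !=set0 -> exists2 B0, F B0 & forall B, F B -> B0 #<= B.
Proof.
move=> F0.
pose P (S : set (set U -> U)) := (forall s B, S s -> F B -> B (s B)) /\
  forall s s' B, S s -> S s' -> F B -> s B = s' B -> s = s'.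
have [K KP Ktot|S [[SB Sinj] Smax]] := @Zorn_bigcup (set U -> U) P.
  split=> [s B [X KX Xs] FB|s s' B [X KX Xs] [Y KY Ys'] FB ss'].
    exact: ((KP _ KX).1 s B).
  have [XY|YX] := Ktot _ _ KX KY.
    by apply: ((KP _ KY).2 s s' B) => //; exact: XY.
  by apply: ((KP _ KX).2 s s' B) => //; exact: YX.
(* Otherwise each set of [F] has a point that no function of [S] takes there; choosing such points
   gives a function [t] that enlarges [S]. *)
have [B0 FB0 B0S] : exists2 B, F B & forall u, B u -> exists2 s, S s & s B = u.
  apply: contrapT => noB; case: F0 => B1 FB1.
  have new B : F B -> exists u, B u /\ forall s, S s -> s B <> u.
    move=> FB; apply: contrapT => nou; apply: noB; exists B => // u Bu.
    by apply: contrapT => nos; apply: nou; exists u; split=> // s Ss sBu;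
       apply: nos; exists s.
  have [u1 [B1u1 _]] := new _ FB1.
  have /choice[t tP] (B : set U) :
      exists u, F B -> B u /\ forall s, S s -> s B <> u.
    have [FB|nFB] := pselect (F B); last by exists u1.
    by have [u uP] := new _ FB; exists u.
  apply: (Smax (S `|` [set t])).
    split=> [?|sub]; first by left.
    have St : S t by apply: sub; right.
    by have [_ /(_ t St)] := tP _ FB1.
  split=> [s B [Ss|->] FB|s s' B [Ss|->] [Ss'|->] FB //]; first exact: (SB s B).
  - by have [] := tP _ FB.
  - exact: (Sinj s s' B).
  - by have [_ /(_ s Ss)] := tP _ FB.
  - by have [_ /(_ s' Ss')] := tP _ FB => + /esym.
exists B0 => // B FB; have B0leS : B0 #<= S.
  apply: card_le_trans (card_image_le (fun s => s B0) S).
  by apply: subset_card_le => u /B0S[s Ss <-]; exists s.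
apply: (card_le_trans B0leS).
apply: (@card_le_fun _ _ _ _ (fun s => s B)) => [s Ss|s s' Ss Ss'].
  exact: (SB s B).
exact: (Sinj s s' B).
Qed.

Lemma card_le_setX T T' (A : set T) (B : set T') :
  A #<= B -> A `*` A #<= B `*` B.
Proof.
have [->|/set0P[a Aa]] := eqVneq A set0; first by rewrite set0X.
have [->|/set0P[b _]] := eqVneq B set0.
  by rewrite card_le0 => /eqP A0; rewrite A0 in Aa.
move=> /(card_le_ex b)[f [fB finj]].
apply: (@card_le_fun _ _ _ _ (fun p => (f p.1, f p.2))) => [[x y] [/= Ax Ay]|].
  by split; exact: fB.
by move=> [x y] [x' y'] /= [Ax Ay] [Ax' Ay'] [] /finj-> // /finj->.
Qed.

(** Both sets inject into [C]; the distinct points [c] and [c'] tag the two images, so the union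
    injects into the square of [C]. *)
Lemma card_le_setU T T' T'' (A B : set T) (C : set T') (D : set T'') :
  (exists c c', [/\ C c, C c' & c <> c']) ->
  A #<= C -> B #<= C -> C `*` C #<= D -> A `|` B #<= D.
Proof.
move=> [c [c' [Cc Cc' cc']]] /(card_le_ex c)[f [fC finj]].
move=> /(card_le_ex c)[g [gC ginj]]; apply: card_le_trans.
apply: (@card_le_fun _ _ _ _ (fun x => if pselect (A x) then (f x, c)
  else (g x, c'))) => [x|x y] ABx.
  by case: pselect => Ax; split=> //=; [exact: fC | case: ABx => // /gC].
move=> ABy; case: pselect => Ax; case: pselect => Ay [] //.
- exact: finj.
- by move=> _ E; case: (cc' (esym E)).
- by case: ABx => // Bx; case: ABy => // By; exact: ginj.
Qed.

(* [G] is the graph of a bijection from [D `*` D] onto [D], where [D] is the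
   range of [G]. *)
Let rng T (G : set ((T * T) * T)) := [set c | exists p, G (p, c)].
Let pairing T (A : set T) (G : set ((T * T) * T)) :=
  [/\ rng G `<=` A,
      (forall p c, G (p, c) -> rng G p.1 /\ rng G p.2),
      (forall a b, rng G a -> rng G b -> exists c, G ((a, b), c)),
      (forall p c c', G (p, c) -> G (p, c') -> c = c') &
      (forall p p' c, G (p, c) -> G (p', c) -> p = p')].

Let pairing_bigcup T (A : set T) (F : set (set ((T * T) * T))) :
  F `<=` pairing A -> total_on F subset -> pairing A (\bigcup_(X in F) X).
Proof.
move=> FP Ftot.
have common q q' : (\bigcup_(X in F) X) q -> (\bigcup_(X in F) X) q' ->
    exists X, [/\ F X, X q & X q'].
  move=> [X FX Xq] [Y FY Yq']; have [XY|YX] := Ftot _ _ FX FY.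
    by exists Y; split=> //; exact: XY.
  by exists X; split=> //; exact: YX.
split.
- by move=> c [p [X FX Xp]]; have [+ _ _ _ _] := FP _ FX; apply; exists p.
- move=> p c [X FX Xp]; have [_ /(_ _ _ Xp)[[q Xq] [q' Xq']] _ _ _] := FP _ FX.
  by split; [exists q; exists X | exists q'; exists X].
- move=> a b [p Up] [q Uq]; have [X [FX Xp Xq]] := common _ _ Up Uq.
  have rXa : rng X a by exists p.
  have rXb : rng X b by exists q.
  by have [_ _ /(_ a b rXa rXb)[c Xc] _ _] := FP _ FX; exists c; exists X.
- move=> p c c' Uc Uc'; have [X [FX Xc Xc']] := common _ _ Uc Uc'.
  by have [_ _ _ + _] := FP _ FX; apply; [exact: Xc|].
- move=> p p' c Uc Uc'; have [X [FX Xc Xc']] := common _ _ Uc Uc'.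
  by have [_ _ _ _ +] := FP _ FX; apply; [exact: Xc|].
Qed.

Let pairing_card T (A : set T) (G : set ((T * T) * T)) :
  pairing A G -> rng G `*` rng G #<= rng G.
Proof.
move=> [_ _ Gtot _ Ginj].
have [->|/set0P[d _]] := eqVneq (rng G) set0; first by rewrite set0X.
have /choice[f fP] (p : T * T) :
    exists c, rng G p.1 -> rng G p.2 -> G (p, c).
  have [[p1 p2]|np] := pselect (rng G p.1 /\ rng G p.2).
    by have [c] := Gtot _ _ p1 p2; rewrite -surjective_pairing => pc; exists c.
  by exists d => p1 p2; case: np.
apply: (@card_le_fun _ _ _ _ f) => [p [p1 p2]|p q [p1 p2] [q1 q2] fpq].
  by exists p; exact: fP.
by apply: (Ginj _ _ (f p)); [exact: fP | rewrite fpq; exact: fP].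
Qed.

(** The pairs not yet in the graph are sent bijectively onto the fresh points [E]; the new values
    cannot collide with the old ones because [E] avoids [rng G]. *)
Let pairing_extend T (A : set T) (G : set ((T * T) * T)) (E : set T) :
  pairing A G -> E `<=` A `\` rng G ->
  ((rng G `|` E) `*` (rng G `|` E)) `\` (rng G `*` rng G) #= E ->
  exists G', [/\ pairing A G', G `<=` G' & rng G' = rng G `|` E].
Proof.
move=> [GA Gdom Gtot Gfun Ginj] EA; set X := _ `\` _ => /card_bijP[f [g fK gK]].
pose G' : set ((T * T) * T) :=
  G `|` [set q | exists x : X, val x = q.1 /\ val (f x) = q.2].
have XP (x : X) : X (val x) by exact: set_valP.
have EP (x : E) : E (val x) by exact: set_valP.
have G'rng : rng G' = rng G `|` E.
  apply/seteqP; split=> [c [p [Gp|[x [_ /= <-]]]]|c [[p Gp]|Ec]].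
  - by left; exists p.
  - by right; exact: EP.
  - by exists p; left.
  - exists (val (g (SigSub (mem_set Ec)))); right.
    by exists (g (SigSub (mem_set Ec))); rewrite gK.
exists G'; split=> //; last by move=> ? ?; left.
split; rewrite ?G'rng.
- by move=> c [/GA//|/EA[]].
- move=> p c [/Gdom[]|[x [/= <- _]]]; first by split; left.
  by have [[]] := XP x.
- move=> a b rEa rEb.
  have [[ra rb]|nr] := pselect (rng G a /\ rng G b).
    by have [c Gc] := Gtot _ _ ra rb; exists c; left.
  have Xab : X (a, b) by split.
  by exists (val (f (SigSub (mem_set Xab)))); right; eexists; split; last by [].
- have mix p c c' (x : X) : G (p, c) -> val x = p -> val (f x) = c' -> c = c'.
    by move=> /Gdom[p1 p2] xp _; have [_] := XP x; case; rewrite xp.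
  move=> p c c' [Gp|[x [/= xp xc]]] [Gp'|[x' [/= xp' xc']]].
  + exact: Gfun Gp'.
  + exact: (mix _ _ _ _ Gp xp' xc').
  + by apply/esym; exact: (mix _ _ _ _ Gp' xp xc).
  + by rewrite -xc -xc'; congr (val (f _)); apply: val_inj; exact: (etrans xp (esym xp')).
- have mix p p' c (x : X) : G (p, c) -> val x = p' -> val (f x) = c -> p = p'.
    move=> Gp _ xc; have [_] := EA _ (EP (f x)); case; rewrite xc.
    by exists p.
  move=> p p' c [Gp|[x [/= xp xc]]] [Gp'|[x' [/= xp' xc']]].
  + exact: Ginj Gp'.
  + exact: (mix _ _ _ _ Gp xp' xc').
  + by apply/esym; exact: (mix _ _ _ _ Gp' xp xc).
  + suff xx' : x = x' by rewrite -xp -xp' xx'.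
    by apply: (can_inj fK); apply: val_inj; exact: (etrans xc (esym xc')).
Qed.

(** Zorn's lemma gives a maximal bijection between the square of some [D] and [D]. If the complement
    of [D] in [A] did not inject into [D], it would contain a copy [E] of [D], over which the
    bijection would extend. Hence [A] injects into [D]. *)
Lemma infinite_card_setX T (A : set T) : infinite_set A -> A `*` A #<= A.
Proof.
move=> /infiniteP natA; have [a Aa] : A !=set0.
  apply: contrapT => /set0P/negP/negPn/eqP A0.
  by move: natA; rewrite A0 card_le0 => /eqP/seteqP[/(_ 0%N I)].
have [u [uA uinj]] := card_le_ex a natA.
have {}uinj : injective u by move=> i j; exact: uinj.
pose N := range u.
have N2 : N `*` N #<= [set: nat * nat].
  have /(card_le_ex 0%N)[v [_ vinj]] : N #<= [set: nat] by exact: card_image_le.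
  apply: (@card_le_fun _ _ _ _ (fun p => (v p.1, v p.2))) => //.
  move=> [x y] [x' y'] /= [Nx Ny] [Nx' Ny'] [].
  by move=> /(vinj _ _ Nx Nx')-> /(vinj _ _ Ny Ny')->.
have natN : [set: nat] #<= N.
  by apply: (@card_le_fun _ _ _ _ u) => [i _|i j _ _ /uinj//]; exists i.
have NN : N `*` N #= N.
  rewrite card_eq_le; apply/andP; split.
    have := card_nat2; rewrite card_eq_le => /andP[le _].
    exact: card_le_trans N2 (card_le_trans le natN).
  have N0 : N (u 0%N) by exists 0%N.
  by apply: (@card_le_fun _ _ _ _ (fun x => (x, u 0%N))) => [x Nx|x y _ _ []].
have [G0 [G0A _ G0N]] : exists G', [/\ pairing A G', set0 `<=` G' & rng G' = N].
  have set0A : pairing A set0 by split=> [c [p]|p c|a' b [p]|p c c'|p p' c].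
  have rng0 : rng (@set0 ((T * T) * T)) = set0 by apply/seteqP; split=> c // [].
  have [||G' [AG' _ rG']] := @pairing_extend _ A set0 N set0A.
  - by rewrite rng0 setD0 => _ [i _ <-]; exact: uA.
  - by rewrite rng0 set0U setX0 setD0.
  - by exists G'; split=> //; rewrite rG' rng0 set0U.
(* Every competitor is united with the seed [G0], so that the empty chain is covered and [D]
   contains the countable set [N]. *)
have [F FP Ftot|G [GA Gmax]] := @Zorn_bigcup _ (fun G => pairing A (G `|` G0)).
  pose F' := [set G0] `|` [set G `|` G0 | G in F].
  suff -> : (\bigcup_(X in F) X) `|` G0 = \bigcup_(X in F') X.
    apply: pairing_bigcup => [_ [->//|[X FX <-]]|]; first exact: FP.
    move=> _ _ [->|[X FX <-]] [->|[Y FY <-]].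
    - by left.
    - by left; right.
    - by right; right.
    - by have [XY|YX] := Ftot _ _ FX FY; [left|right]; exact: setSU.
  apply/seteqP; split=> [q [[X FX Xq]|G0q]|q [_ [->|[X FX <-]]]].
  - by exists (X `|` G0); [right; exists X|left].
  - by exists G0; [left|].
  - by right.
  - by move=> [Xq|]; [left; exists X|right].
pose D := rng (G `|` G0).
have ND : N `<=` D by rewrite -G0N => c [p ?]; exists p; right.
have DD : D `*` D #<= D := pairing_card GA.
have D2 : exists c c', [/\ D c, D c' & c <> c'].
  exists (u 0%N), (u 1%N); split; [by apply: ND; exists 0%N|by apply: ND; exists 1%N|].
  by move=> /uinj.
have DA : D `<=` A by case: GA.
have [|DAD] := pselect (A `\` D #<= D).
  move=> AD; have A_D : A #<= D.
    by rewrite -(setUIDK A D) setIC (setIidl DA); exact: card_le_setU D2 _ AD DD.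
  apply: card_le_trans (card_le_setX A_D) (card_le_trans DD _).
  exact: subset_card_le.
have {}DAD : D #<= A `\` D.
  (* Two cardinals are comparable because a pair of sets has a least member. *)
  have [B0 [->|->] B0min] := @card_le_min _ [set D; A `\` D] (ex_intro _ D (or_introl erefl)).
    by apply: B0min; right.
  by case: DAD; apply: B0min; left.
have [w [wAD winj]] := card_le_ex (u 0%N) DAD.
pose E := w @` D.
have EAD : E `<=` A `\` D by move=> _ [x Dx <-]; exact: wAD.
have ED : E #<= D by exact: card_image_le.
have DE : D #<= E by apply: (@card_le_fun _ _ _ _ w) => // x Dx; exists x.
have [||G' [AG' GG' rG']] := pairing_extend GA (E := E); first exact: EAD.
  rewrite card_eq_le; apply/andP; split.
    apply: (@card_le_trans _ _ _ ((D `|` E) `*` (D `|` E))).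
      by apply: subset_card_le => ? [].
    apply: card_le_trans (card_le_trans DD DE); apply: card_le_setX.
    exact: card_le_setU D2 _ ED DD.
  have [d [_ [Dd _ _]]] := D2.
  apply: (@card_le_fun _ _ _ _ (fun x => (x, d))) => [x Ex|x y _ _ []//].
  split; first by split; [right|left].
  by move=> [/= Dx _]; have [] := EAD _ Ex.
have G'G0 : G' `|` G0 = G' by apply/setUidPl => q ?; apply: GG'; right.
case: (Gmax G'); last by rewrite G'G0.
split=> [q ?|G'G]; first by apply: GG'; left.
have Ew : E (w (u 0%N)) by exists (u 0%N) => //; apply: ND; exists 0%N.
have [_] := EAD _ Ew; case.
suff -> : D = rng G' by rewrite rG'; right.
congr rng; apply/seteqP; split=> // q /G'G; by left.
Qed.

End Cardinals.

(** Dense families are functions on an index type, so reindexing them calls for surjections. *)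
Definition surjects I T := exists f : I -> T, forall y, exists x, f x = y.

Lemma surjects_trans I J K : surjects I J -> surjects J K -> surjects I K.
Proof.
move=> [f fP] [g gP]; exists (g \o f) => z.
by have [y <-] := gP z; have [x <-] := fP y; exists x.
Qed.

Lemma card_le_surjects J T (t : T) : [set: T] #<= [set: J] -> surjects J T.
Proof.
move=> TJ; have [j] : inhabited J.
  by have /card_leP[h] := TJ; constructor; exact: val (h (SigSub (mem_set (I : setT t)))).
have [f [_ finj]] := card_le_ex j TJ.
have /choice[g gP] (x : J) : exists y, forall y', f y' = x -> y' = y.
  have [[y <-]|nfx] := pselect (exists y, f y = x); last first.
    by exists t => y' fy'; case: nfx; exists y'.
  by exists y => y'; exact: finj.
by exists g => y; exists (f y); exact/esym/gP.
Qed.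

(** * Reindexing by an infinite set *)

Section Index.
Variables (I : Type) (infI : infinite_set [set: I]).

Lemma surjects_nat : surjects I nat.
Proof. by apply: (card_le_surjects 0%N); exact/infiniteP. Qed.

Lemma index_inhabited : inhabited I.
Proof. by have [f /(_ 0%N)[i _]] := surjects_nat. Qed.

Lemma surjects_square : surjects I (I * I).
Proof.
have [i] := index_inhabited; apply: (card_le_surjects (i, i)).
by have := infinite_card_setX infI; rewrite setXTT.
Qed.

Lemma surjects_prod T U : surjects I T -> surjects I U -> surjects I (T * U).
Proof.
move=> [f fP] [g gP]; apply: surjects_trans surjects_square _.
exists (fun p => (f p.1, g p.2)) => -[t u].
by have [i <-] := fP t; have [j <-] := gP u; exists (i, j).
Qed.

(** A sequence is coded by its length and a single index, which repeated splitting through the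
    surjection onto [I * I] turns into the entries. *)
Lemma surjects_seq T : surjects I T -> surjects I (seq T).
Proof.
move=> [f fP]; have [p pP] := surjects_square.
pose dec := fix dec n i := if n is n'.+1 then f (p i).1 :: dec n' (p i).2 else [::].
apply: surjects_trans (surjects_prod surjects_nat (ex_intro _ id (fun y => ex_intro _ y erefl))) _.
exists (fun q => dec q.1 q.2) => s.
have [i0] := index_inhabited.
elim: s => [|t s [[n i] /= <-]]; first by exists (0%N, i0).
have [j <-] := fP t; have [k pk] := pP (j, i).
by exists (n.+1, k); rewrite /= pk.
Qed.

End Index.

(** * Pseudometrics and bikat functions *)

Section Pseudometric.
Context {R : realType}.

(** Inserting [1] keeps the set nonempty for every [P] and truncates all distances at [1]. *)
Definition inf1 (P : R -> Prop) : R := inf ([set 1] `|` [set r | 0 <= r /\ P r]).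

Let has_inf1 (P : R -> Prop) : has_inf ([set 1] `|` [set r | 0 <= r /\ P r]).
Proof.
split; first by exists 1; left.
by exists 0 => _ [->|[]//]; exact: ler01.
Qed.

Lemma inf1_le1 P : inf1 P <= 1.
Proof. by apply: ge_inf; [have [] := has_inf1 P | left]. Qed.

Lemma inf1_le (P : R -> Prop) r : 0 <= r -> P r -> inf1 P <= r.
Proof. by move=> r0 Pr; apply: ge_inf; [have [] := has_inf1 P | right]. Qed.

Lemma le_inf1 (P : R -> Prop) c :
  c <= 1 -> (forall r, 0 <= r -> P r -> c <= r) -> c <= inf1 P.
Proof.
move=> c1 cP; apply: lb_le_inf; first by have [] := has_inf1 P.
by move=> r [->|[r0 Pr]] //; exact: cP.
Qed.

Lemma inf1_ge0 P : 0 <= inf1 P.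
Proof. by apply: le_inf1 => //; exact: ler01. Qed.

Lemma le_inf1D (P Q : R -> Prop) c : c <= 1 ->
  (forall r s, 0 <= r -> 0 <= s -> P r -> Q s -> c <= r + s) ->
  c <= inf1 P + inf1 Q.
Proof.
move=> c1 cPQ; rewrite -lerBlDr; apply: le_inf1 => [|r r0 Pr].
  by have := inf1_ge0 Q; lra.
rewrite lerBlDl -lerBlDr; apply: le_inf1 => [|s s0 Qs]; first by lra.
by rewrite lerBlDr addrC; exact: cPQ.
Qed.

Section OnX.
Variable X : Type.
Implicit Types (d phi : X -> X -> R) (L : X -> X -> R -> Prop) (x y z : X).

Record pmetric d : Prop := Pmetric {
  pm0 : forall x, d x x = 0 ;
  pmC : forall x y, d x y = d y x ;
  pmD : forall x y z, d x z <= d x y + d y z ;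
  pm_le1 : forall x y, d x y <= 1 }.

Lemma pm_ge0 d x y : pmetric d -> 0 <= d x y.
Proof.
move=> dP; have := pmD dP x y x; rewrite (pm0 dP) (pmC dP y x); lra.
Qed.

(* [phi] is the cross distance of a pseudometric on the disjoint union of two
   copies of [X] that extends [d] on both of them. *)
Record bikat d phi : Prop := Bikat {
  bk_ge0 : forall x y, 0 <= phi x y ;
  bk_le1 : forall x y, phi x y <= 1 ;
  bk_lipl : forall x x' y, phi x y <= d x x' + phi x' y ;
  bk_lipr : forall x y y', phi x y <= phi x y' + d y' y ;
  bk_dl : forall x x' y, d x x' <= phi x y + phi x' y ;
  bk_dr : forall x y y', d y y' <= phi x y + phi x y' }.

Definition transp phi x y := phi y x.

(* The cross distance obtained by joining [p] in the first copy of [X] to [q]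
   in the second one by an edge of length [l], for all [L p q l]. *)
Definition glue d L x y : R :=
  inf1 (fun r => exists p q l, [/\ 0 <= l, L p q l & r = d x p + l + d q y]).

(** Crossing by one link and returning by another is never a shortcut inside either copy of [X]. *)
Definition consistent d L : Prop :=
  forall p q l p' q' l', 0 <= l -> 0 <= l' -> L p q l -> L p' q' l' ->
    d p p' <= d q q' + (l + l') /\ d q q' <= d p p' + (l + l').

Lemma glue_le1 d L x y : glue d L x y <= 1.
Proof. exact: inf1_le1. Qed.

Lemma glue_le d L x y p q l : pmetric d -> 0 <= l -> L p q l ->
  glue d L x y <= d x p + l + d q y.
Proof.
move=> dP l0 Ll; apply: inf1_le; last by exists p, q, l.
by rewrite !addr_ge0// pm_ge0.
Qed.

Lemma glue_le0 d L p q l : pmetric d -> 0 <= l -> L p q l -> glue d L p q <= l.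
Proof.
move=> dP l0 Ll; have := glue_le p q dP l0 Ll.
by rewrite !(pm0 dP) add0r addr0.
Qed.

Lemma le_glue d L x y c : c <= 1 ->
  (forall p q l, 0 <= l -> L p q l -> c <= d x p + l + d q y) ->
  c <= glue d L x y.
Proof. by move=> c1 cL; apply: le_inf1 => // _ _ [p [q [l [? ? ->]]]]; exact: cL. Qed.

Lemma glue_bikat d L : pmetric d -> consistent d L -> bikat d (glue d L).
Proof.
move=> dP Lc; split.
- by move=> x y; exact: inf1_ge0.
- by move=> x y; exact: inf1_le1.
- move=> x x' y; rewrite -lerBlDl; apply: le_glue => [|p q l l0 Ll].
    by have := pm_ge0 x x' dP; have := glue_le1 d L x y; lra.
  have := glue_le x y dP l0 Ll; have := pmD dP x x' p; lra.
- move=> x y y'; rewrite -lerBlDr; apply: le_glue => [|p q l l0 Ll].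
    by have := pm_ge0 y' y dP; have := glue_le1 d L x y; lra.
  have := glue_le x y dP l0 Ll; have := pmD dP q y' y; lra.
- move=> x x' y; apply: le_inf1D => [|_ s _ _ [p [q [l [l0 Ll ->]]]]].
    exact: pm_le1.
  move=> [p' [q' [l' [l'0 Ll' ->]]]]; have [pq _] := Lc _ _ _ _ _ _ l0 l'0 Ll Ll'.
  have := pmD dP x p x'; have := pmD dP p p' x'; have := pmD dP q y q'.
  by rewrite (pmC dP p' x') (pmC dP y q'); lra.
- move=> x y y'; apply: le_inf1D => [|_ s _ _ [p [q [l [l0 Ll ->]]]]].
    exact: pm_le1.
  move=> [p' [q' [l' [l'0 Ll' ->]]]]; have [_ pq] := Lc _ _ _ _ _ _ l0 l'0 Ll Ll'.
  have := pmD dP y q y'; have := pmD dP q q' y'; have := pmD dP p x p'.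
  by rewrite (pmC dP y q) (pmC dP p x); lra.
Qed.

(** Replacing a link of [L] by its substitute in [L'] lengthens a path by at most [e]. *)
Lemma glue_lip d L L' e x y : pmetric d -> 0 <= e ->
  (forall p q l, 0 <= l -> L p q l -> exists p' q' l',
    [/\ 0 <= l', L' p' q' l' & d p p' + d q q' + l' <= l + e]) ->
  glue d L' x y <= glue d L x y + e.
Proof.
move=> dP e0 LL'; rewrite -lerBlDr; apply: le_glue => [|p q l l0 Ll].
  by have := glue_le1 d L' x y; lra.
have [p' [q' [l' [l'0 Ll' le]]]] := LL' _ _ _ l0 Ll.
have := glue_le x y dP l'0 Ll'; have := pmD dP x p p'; have := pmD dP q' q y.
by rewrite (pmC dP q' q); lra.
Qed.

(** Besides the [k] links, every point is joined to its own copy by an edge of length [e]; this is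
    what keeps the associated isometry within [e] of the identity. *)
Definition link_rel (k : nat) (a b : nat -> X) (r : nat -> R) (e : R) p q l :=
  (p = q /\ l = e) \/ exists2 i, (i < k)%N & [/\ p = a i, q = b i & l = r i].

Definition link d k a b r e := glue d (link_rel k a b r e).

(** Consistency spelled out: [lo_d] compares a link with the edges of length [e], and [lo_ab],
    [lo_ba] compare two links. *)
Record link_ok d k (a b : nat -> X) (r : nat -> R) e : Prop := LinkOk {
  lo_e : 0 <= e ;
  lo_r : forall i, (i < k)%N -> 0 <= r i ;
  lo_d : forall i, (i < k)%N -> d (a i) (b i) <= r i + e ;
  lo_ab : forall i j, (i < k)%N -> (j < k)%N ->
    d (a i) (a j) <= d (b i) (b j) + (r i + r j) ;
  lo_ba : forall i j, (i < k)%N -> (j < k)%N ->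
    d (b i) (b j) <= d (a i) (a j) + (r i + r j) }.

Lemma link_bikat d k a b r e :
  pmetric d -> link_ok d k a b r e -> bikat d (link d k a b r e).
Proof.
move=> dP [e0 r0 dab ab ba]; apply: glue_bikat => // p q l p' q' l' _ _.
move=> [[<- ->]|[i ik [-> -> ->]]] [[<- ->]|[j jk [-> -> ->]]].
- by have := e0; lra.
- have := pmD dP p (b j) (a j); have := pmD dP p (a j) (b j).
  by rewrite (pmC dP (b j) (a j)); have := dab _ jk; lra.
- have := pmD dP (b i) (a i) p'; have := pmD dP (a i) (b i) p'.
  by rewrite (pmC dP (b i) (a i)); have := dab _ ik; lra.
- by have := ab _ _ ik jk; have := ba _ _ ik jk; lra.
Qed.

Lemma link_refl d k a b r e x y : pmetric d -> 0 <= e ->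
  link d k a b r e x y <= d x y + e.
Proof.
move=> dP e0; have := @glue_le d (link_rel k a b r e) x y x x e dP e0.
by rewrite (pm0 dP) add0r addrC; apply; left.
Qed.

Lemma link_near d k a b r e : pmetric d -> link_ok d k a b r e ->
  forall x y, `|link d k a b r e x y - d x y| <= e.
Proof.
move=> dP [e0 r0 dab _ _] x y; rewrite ler_norml.
have := link_refl k a b r x y dP e0.
have : d x y - e <= link d k a b r e x y; last by move=> ? ?; apply/andP; split; lra.
apply: le_glue => [|p q l l0 [[<- ->]|[i ik [-> -> ->]]]].
- by have := pm_le1 dP x y; lra.
- by have := pmD dP x p y; lra.
- have := pmD dP x (a i) y; have := pmD dP (a i) (b i) y; have := dab _ ik; lra.
Qed.

End OnX.

End Pseudometric.

(** * Adjoining the images of points under bikat functions *)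

Section Step.
Context {R : realType}.
Variables (X : Type) (d : X -> X -> R) (Good : (X -> X -> R) -> Prop).
Hypotheses (dP : pmetric d) (dG : Good d).
Hypothesis GoodP : forall f, Good f -> bikat d f.
Hypothesis GoodT : forall f, Good f -> Good (transp f).

(* The pair [(x, f)] stands for the image of [x] under an isometry whose cross
   distance is [f]. *)
Definition step : Type := X * {f | Good f}.

Implicit Types (p q : step) (f h : {f | Good f}).

Let bk f : bikat d (sval f) := GoodP (svalP f).

(** A route either passes through a point [y] of [X], or changes the point inside one copy and pays
    the uniform distance between the two functions. *)
Definition sdist p q : R := inf1 (fun r =>
  (exists y, r = sval p.2 p.1 y + sval q.2 q.1 y) \/
  (exists e, [/\ 0 <= e, forall x y, `|sval p.2 x y - sval q.2 x y| <= e &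
                 r = d p.1 q.1 + e])).

Let sdist_le1 p q y : sdist p q <= sval p.2 p.1 y + sval q.2 q.1 y.
Proof.
apply: inf1_le; last by left; exists y.
by rewrite addr_ge0// (bk_ge0 (bk _)).
Qed.

Lemma sdist_le2 p q e : (forall x y, `|sval p.2 x y - sval q.2 x y| <= e) ->
  sdist p q <= d p.1 q.1 + e.
Proof.
move=> pqe; have e0 : 0 <= e by exact: le_trans (normr_ge0 _) (pqe p.1 p.1).
by apply: inf1_le; [rewrite addr_ge0// pm_ge0|right; exists e].
Qed.

Lemma le_sdist p q c : c <= 1 ->
  (forall y, c <= sval p.2 p.1 y + sval q.2 q.1 y) ->
  (forall e, 0 <= e -> (forall x y, `|sval p.2 x y - sval q.2 x y| <= e) ->
    c <= d p.1 q.1 + e) ->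
  c <= sdist p q.
Proof.
by move=> c1 c2 c3; apply: le_inf1 => // r _ [[y ->]|[e [e0 pqe ->]]]; [exact: c2|exact: c3].
Qed.

Lemma sdist_pm : pmetric sdist.
Proof.
have le_sym p q : sdist p q <= sdist q p.
  apply: le_sdist; first exact: inf1_le1.
  - by move=> y; rewrite addrC; exact: sdist_le1.
  - move=> e e0 pqe; rewrite (pmC dP); apply: sdist_le2 => x y.
    by rewrite distrC.
split.
- move=> p; apply/eqP; rewrite eq_le inf1_ge0 andbT.
  by rewrite -[leRHS](pm0 dP p.1) -[leRHS]addr0; apply: sdist_le2 => x y; rewrite subrr normr0.
- by move=> p q; apply/eqP; rewrite eq_le !le_sym.
- move=> p q s; apply: le_inf1D; first exact: inf1_le1.
  move=> _ _ _ _ [[y ->]|[e [e0 pqe ->]]] [[z ->]|[e' [e'0 qse ->]]].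
  + have := sdist_le1 p s y; have := bk_lipr (bk s.2) s.1 y z.
    have := bk_dr (bk q.2) q.1 z y; lra.
  + have := sdist_le1 p s y; have := bk_lipl (bk s.2) s.1 q.1 y.
    rewrite (pmC dP s.1); have := qse q.1 y; rewrite ler_norml; lra.
  + have := sdist_le1 p s z; have := bk_lipl (bk p.2) p.1 q.1 z.
    have := pqe q.1 z; rewrite ler_norml; lra.
  + have := pmD dP p.1 q.1 s.1.
    suff : sdist p s <= d p.1 s.1 + (e + e') by lra.
    apply: sdist_le2 => x y; have := pqe x y; have := qse x y.
    by rewrite !ler_norml; lra.
- by move=> p q; exact: inf1_le1.
Qed.

Definition inc x : step := (x, exist Good d dG).

Lemma sdist_inc x f y : sdist (x, f) (inc y) = sval f x y.
Proof.
apply/eqP; rewrite eq_le; apply/andP; split.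
  by have := sdist_le1 (x, f) (inc y) y; rewrite /= (pm0 dP) addr0.
apply: le_sdist => /= [|z|e e0 fe]; first exact: bk_le1 (bk f) _ _.
- by rewrite (pmC dP); exact: bk_lipr (bk f) _ _ _.
- by have := fe x y; rewrite ler_norml; lra.
Qed.

Lemma sdist_incl x y f : sdist (inc y) (x, f) = sval f x y.
Proof. by rewrite (pmC sdist_pm) sdist_inc. Qed.

Lemma sdist_inc2 x y : sdist (inc x) (inc y) = d x y.
Proof. exact: sdist_inc. Qed.

Lemma sdist_same x x' f : sdist (x, f) (x', f) = d x x'.
Proof.
apply/eqP; rewrite eq_le; apply/andP; split.
  by rewrite -[leRHS]addr0; apply: sdist_le2 => /= a b; rewrite subrr normr0.
apply: le_sdist => /= [|y|e e0 _]; first exact: pm_le1.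
- exact: bk_dl (bk f) _ _ _.
- by rewrite lerDl.
Qed.

Definition trG f : {f | Good f} := exist Good _ (GoodT (svalP f)).

(** The first link makes [(z, f)] the image of [z], the second makes [(z, trG f)] its preimage, and
    the third keeps the extension as close to the identity as [f] is. *)
Definition ext_rel f p q (l : R) :=
  [\/ exists z, [/\ p = inc z, q = (z, f) & l = 0],
      exists z, [/\ p = (z, trG f), q = inc z & l = 0] |
      p = q /\ forall x y, `|sval f x y - d x y| <= l].

Definition ext f p q : R := glue sdist (ext_rel f) p q.

Let DP := sdist_pm.

Lemma ext_bikat f : bikat sdist (ext f).
Proof.
apply: glue_bikat => //.
(* If [f] is within [l] of [d], then [(x, f)] is within [l] of [x]. This settles the third kind of
   link against the first; [far'] settles it against the second. *)
have far p x l : (forall x y, `|sval f x y - d x y| <= l) ->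
    sdist p (inc x) <= sdist p (x, f) + l /\ sdist p (x, f) <= sdist p (inc x) + l.
  move=> fl; have : sdist (x, f) (inc x) <= l.
    by rewrite sdist_inc; have := fl x x; rewrite (pm0 dP) subr0; exact: le_trans (ler_norm _).
  have := pmD DP p (x, f) (inc x); have := pmD DP p (inc x) (x, f).
  by rewrite (pmC DP (inc x) (x, f)); lra.
have far' p x l : (forall x y, `|sval f x y - d x y| <= l) ->
    sdist p (inc x) <= sdist p (x, trG f) + l /\ sdist p (x, trG f) <= sdist p (inc x) + l.
  move=> fl; have : sdist (x, trG f) (inc x) <= l.
    by rewrite sdist_inc; have := fl x x; rewrite (pm0 dP) subr0; exact: le_trans (ler_norm _).
  have := pmD DP p (x, trG f) (inc x); have := pmD DP p (inc x) (x, trG f).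
  by rewrite (pmC DP (inc x) (x, trG f)); lra.
move=> p q l p' q' l' l0 l'0.
case=> [[z [-> -> ->]]|[z [-> -> ->]]|[<- fl]];
  case=> [[z' [-> -> ->]]|[z' [-> -> ->]]|[<- fl']].
- by rewrite sdist_inc2 sdist_same; lra.
- by rewrite sdist_incl sdist_inc /= /transp; lra.
- by rewrite !(pmC DP _ p'); have := far p' z _ fl'; lra.
- by rewrite sdist_incl sdist_inc /= /transp; lra.
- by rewrite sdist_inc2 sdist_same; lra.
- by rewrite !(pmC DP _ p'); have := far' p' z _ fl'; lra.
- by have := far p z' _ fl; lra.
- by have := far' p z' _ fl; lra.
- by lra.
Qed.

Lemma ext_zerol f x : ext f (inc x) (x, f) = 0.
Proof.
apply/eqP; rewrite eq_le inf1_ge0 andbT; apply: glue_le0 => //.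
by constructor 1; exists x.
Qed.

Lemma ext_zeror f x : ext f (x, trG f) (inc x) = 0.
Proof.
apply/eqP; rewrite eq_le inf1_ge0 andbT; apply: glue_le0 => //.
by constructor 2; exists x.
Qed.

Lemma ext_inc f x y : ext f (inc x) (inc y) = sval f x y.
Proof.
apply/eqP; rewrite eq_le; apply/andP; split.
  have := bk_lipr (ext_bikat f) (inc x) (inc y) (x, f).
  by rewrite ext_zerol sdist_inc add0r.
apply: le_glue; first exact: bk_le1 (bk f) _ _.
move=> p q l l0 [[z [-> -> ->]]|[z [-> -> ->]]|[<- fl]].
- by rewrite sdist_inc2 sdist_inc addr0; exact: bk_lipl (bk f) _ _ _.
- by rewrite sdist_incl sdist_inc2 addr0 /= /transp; exact: bk_lipr (bk f) _ _ _.
- have := pmD DP (inc x) p (inc y); rewrite sdist_inc2.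
  by have := fl x y; rewrite ler_norml; lra.
Qed.

(** Keeps the bound on the displacement through all stages of the tower. *)
Lemma ext_near f e : (forall x y, `|sval f x y - d x y| <= e) ->
  forall p q, `|ext f p q - sdist p q| <= e.
Proof.
move=> fe p q; have e0 : 0 <= e by exact: le_trans (normr_ge0 _) (fe p.1 p.1).
have : ext f p q <= e + sdist p q.
  rewrite -[e]add0r -(pm0 DP p); apply: glue_le => //.
  by constructor 3.
have zero z : sval f z z <= e.
  by have := fe z z; rewrite (pm0 dP) subr0; exact: le_trans (ler_norm _).
have : sdist p q - e <= ext f p q.
  apply: le_glue => [|p' q' l l0]; first by have := pm_le1 DP p q; lra.
  case=> [[z [-> -> ->]]|[z [-> -> ->]]|[<- fl]].
  - have := pmD DP p (inc z) q; have := pmD DP (inc z) (z, f) q.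
    by rewrite sdist_incl; have := zero z; lra.
  - have := pmD DP p (z, trG f) q; have := pmD DP (z, trG f) (inc z) q.
    by rewrite sdist_inc /= /transp; have := zero z; lra.
  - by have := pmD DP p p' q; lra.
by move=> ? ?; rewrite ler_norml; apply/andP; split; lra.
Qed.

(** Transfers to the extended functions both the density of a family of functions and the continuity
    of the group action. *)
Lemma ext_lip f h e : (forall x y, `|sval f x y - sval h x y| <= e) ->
  forall p q, `|ext f p q - ext h p q| <= e.
Proof.
suff lip f' h' : (forall x y, `|sval f' x y - sval h' x y| <= e) ->
    forall p q, ext h' p q <= ext f' p q + e.
  move=> fh p q; have := lip _ _ fh p q.
  have : ext f p q <= ext h p q + e by apply: lip => x y; rewrite distrC.
  by move=> ? ?; rewrite ler_norml; apply/andP; split; lra.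
move=> fh p q; have e0 : 0 <= e by exact: le_trans (normr_ge0 _) (fh p.1 p.1).
apply: glue_lip => // p' q' l l0.
case=> [[z [-> -> ->]]|[z [-> -> ->]]|[<- fl]].
- exists (inc z), (z, h'), 0; split=> //; first by constructor 1; exists z.
  have := sdist_le2 (p := (z, f')) (q := (z, h')) fh.
  by rewrite (pm0 DP) /= (pm0 dP); lra.
- exists (z, trG h'), (inc z), 0; split=> //; first by constructor 2; exists z.
  have := sdist_le2 (p := (z, trG f')) (q := (z, trG h')) (fun x y => fh y x).
  by rewrite (pm0 DP) /= (pm0 dP); lra.
- exists p', p', (l + e); split; [by rewrite addr_ge0| |by rewrite (pm0 DP); lra].
  constructor 3; split=> // x y; have := fl x y; have := fh x y.
  by rewrite !ler_norml => /andP[? ?] /andP[? ?]; apply/andP; split; lra.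
Qed.

Lemma trGK f : trG (trG f) = f.
Proof. by case: f => f Gf; exact: eq_exist. Qed.

Lemma ext_tr f p q : ext (trG f) p q = ext f q p.
Proof.
suff le h p' q' : ext (trG h) p' q' <= ext h q' p'.
  by apply/eqP; rewrite eq_le le -{1}(trGK f) le.
apply: le_glue; first exact: glue_le1.
move=> a b l l0; rewrite (pmC DP q') (pmC DP b) => ab.
have -> : sdist a q' + l + sdist p' b = sdist p' b + l + sdist a q' by lra.
apply: glue_le => //.
case: ab => [[z [-> -> ->]]|[z [-> -> ->]]|[<- fl]].
- by constructor 2; exists z; rewrite trGK.
- by constructor 1; exists z.
- by constructor 3; split=> // x y; rewrite /= /transp (pmC dP).
Qed.

End Step.

(** * Equivariance of the extension step *)

Section Equivariance.
Context {R : realType}.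
Variables (X : Type) (d : X -> X -> R) (Good : (X -> X -> R) -> Prop).
Hypotheses (dP : pmetric d) (dG : Good d).
Hypothesis GoodP : forall f, Good f -> bikat d f.
Hypothesis GoodT : forall f, Good f -> Good (transp f).

Definition conjf (g : X -> X) (f : X -> X -> R) x y := f (g x) (g y).

Variables (g g' : X -> X).
Hypotheses (gK : cancel g g') (g'K : cancel g' g).
Hypothesis gd : forall x y, d (g x) (g y) = d x y.
Hypothesis gG : forall f, Good f -> Good (conjf g' f).

(** The image of [x] under [f] must go to the image of [g x] under the conjugate of [f] by [g],
    whose cross distance is obtained by applying the inverse [g'] to both arguments. *)
Definition step_act (p : step Good) : step Good :=
  (g p.1, exist Good _ (gG (svalP p.2))).

Lemma step_act_inc x : step_act (inc dG x) = inc dG (g x).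
Proof.
congr (_, _); apply: eq_exist; apply/funext => a; apply/funext => b.
by rewrite /conjf /= -gd !g'K.
Qed.

Lemma step_act_isometry p q : sdist d (step_act p) (step_act q) = sdist d p q.
Proof.
apply/eqP; rewrite eq_le; apply/andP; split.
  apply: le_sdist; first exact: pm_le1 (sdist_pm dP GoodP) _ _.
  - move=> y; apply: inf1_le.
      by rewrite addr_ge0// (bk_ge0 (GoodP (svalP _))).
    by left; exists (g y); rewrite /= /conjf !gK.
  - move=> e e0 pqe; rewrite -[X in _ <= X + _]gd; apply: (sdist_le2 dP (p := step_act p) (q := step_act q)).
    by move=> x y; exact: pqe.
apply: le_sdist; first exact: pm_le1 (sdist_pm dP GoodP) _ _.
- move=> y; apply: inf1_le.
    by rewrite addr_ge0// (bk_ge0 (GoodP (svalP (step_act _).2))).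
  by left; exists (g' y); rewrite /= /conjf !gK.
- move=> e e0 pqe; rewrite /= gd; apply: (sdist_le2 dP) => x y.
  by have := pqe (g x) (g y); rewrite /= /conjf !gK.
Qed.

(** The action carries the links of [f] to links of its conjugate and preserves distances. The
    reverse inequality is the same statement for the inverse. *)
Lemma step_act_ext (f : {f | Good f}) p q :
  ext dG GoodT (exist Good _ (gG (svalP f))) (step_act p) (step_act q) <=
  ext dG GoodT f p q.
Proof.
apply: le_glue; first exact: glue_le1.
move=> a b l l0 ab.
rewrite -[X in X + _ + _]step_act_isometry -[X in _ + _ + X]step_act_isometry.
apply: glue_le => //; first exact: sdist_pm.
case: ab => [[z [-> -> ->]]|[z [-> -> ->]]|[<- fl]].
- by constructor 1; exists (g z); rewrite step_act_inc.
- constructor 2; exists (g z); rewrite step_act_inc; split=> //.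
  by congr (_, _); exact: eq_exist.
- constructor 3; split=> // x y; rewrite /= /conjf.
  by have <- : d (g' x) (g' y) = d x y by rewrite -gd !g'K.
Qed.

End Equivariance.

(** * The tower of extensions *)

Section Link.
Context {R : realType}.
Variables (X : Type) (d : X -> X -> R).
Hypothesis dP : pmetric d.
Implicit Types (a b : nat -> X) (r : nat -> R).

(** Uniform dependence on the link data: the source of the continuity of the action on functions and
    of small dense families of links. *)
Lemma link_lip k a b r e a' b' r' e' eta : 0 <= eta -> 0 <= e' -> e' <= e + eta ->
  (forall i, (i < k)%N ->
    0 <= r' i /\ d (a i) (a' i) + d (b i) (b' i) + r' i <= r i + eta) ->
  forall x y, link d k a' b' r' e' x y <= link d k a b r e x y + eta.
Proof.
move=> eta0 e'0 ee' ab x y; apply: glue_lip => // p q l l0.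
move=> [[<- ->]|[i ik [-> -> ->]]].
  by exists p, p, e'; split=> //; [left|rewrite (pm0 dP); lra].
have [r'0 abi] := ab _ ik.
by exists (a' i), (b' i), (r' i); split=> //; right; exists i.
Qed.

Lemma link_transp k a b r e : transp (link d k a b r e) = link d k b a r e.
Proof.
suff le a' b' x y : link d k a' b' r e y x <= link d k b' a' r e x y.
  by apply/funext => x; apply/funext => y; apply/eqP; rewrite eq_le !le.
apply: le_glue => [|p q l l0 pq]; first exact: glue_le1.
have -> : d x p + l + d q y = d y q + l + d p x.
  by rewrite (pmC dP x) (pmC dP q); lra.
apply: glue_le => //.
by case: pq => [[-> ->]|[i ik [-> -> ->]]]; [left|right; exists i].
Qed.

Lemma link_conj g g' k a b r e :
  cancel g g' -> cancel g' g -> (forall x y, d (g x) (g y) = d x y) ->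
  conjf g' (link d k a b r e) = link d k (g \o a) (g \o b) r e.
Proof.
move=> gK g'K gd; have g'd x y : d (g' x) y = d x (g y) by rewrite -gd g'K.
have dg' x y : d x (g' y) = d (g x) y by rewrite -gd g'K.
apply/funext => x; apply/funext => y; apply/eqP; rewrite /conjf eq_le.
apply/andP; split; (apply: le_glue => [|p q l l0 pq]; first exact: glue_le1).
- have -> : d x p + l + d q y = d (g' x) (g' p) + l + d (g' q) (g' y).
    by rewrite g'd !g'K dg' g'K.
  apply: glue_le => //; case: pq => [[-> ->]|[i ik [-> -> ->]]]; first by left.
  by right; exists i; rewrite //= !gK.
- rewrite g'd dg'; apply: glue_le => //.
  by case: pq => [[-> ->]|[i ik [-> -> ->]]]; [left|right; exists i].
Qed.

(** The identity is itself finitely linked, so [d] belongs to every family closed under links. *)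
Lemma link0 a b r : link d 0 a b r 0 = d.
Proof.
have ok : link_ok d 0 a b r 0 by split=> // *; rewrite lexx.
apply/funext => x; apply/funext => y; apply/eqP; rewrite -subr_eq0 -normr_le0.
exact: link_near.
Qed.

End Link.

(** * Dyadic errors and dense families *)

Section Approximation.
Context {R : realType}.

Definition halfn (n : nat) : R := 2^-1 ^+ n.

Lemma halfn_gt0 n : 0 < halfn n.
Proof. by rewrite exprn_gt0// invr_gt0. Qed.

Lemma halfnS n : halfn n = halfn n.+1 + halfn n.+1.
Proof. by rewrite /halfn exprS; lra. Qed.

Lemma halfn0 : halfn 0 = 1.
Proof. exact: expr0. Qed.

Lemma halfn_lt e : 0 < e -> exists n, halfn n < e.
Proof.
move=> e0; have [n] := ltr_add_invr e0; rewrite add0r => ne; exists n.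
apply: le_lt_trans ne; rewrite /halfn exprVn lef_pV2 ?posrE ?exprn_gt0//.
by rewrite -natrX ler_nat ltn_expl.
Qed.

(** The approximation is from above, so that approximate link lengths stay nonnegative. *)
Lemma dense_ge0 : exists q : nat -> R, forall r e, 0 <= r -> 0 < e ->
  exists n, r <= q n <= r + e.
Proof.
exists (fun n => ratr (odflt 0 (unpickle n))) => r e r0 e0.
have [] := @rat_in_itvoo R r (r + e); first by rewrite ltrDl.
by move=> q /[!in_itv]/= /andP[rq qe]; exists (pickle q); rewrite pickleK /= !ltW.
Qed.

(* [D x y e] reads: [x] and [y] are at distance at most [e]. *)
Lemma dense_subset (J T : Type) (D : T -> T -> R -> Prop) (A : set T) (v : J -> T) (t0 : T) :
  infinite_set [set: J] -> A t0 ->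
  (forall x y z e e', D x y e -> D x z e' -> D y z (e + e')) ->
  (forall x y e e', e <= e' -> D x y e -> D x y e') ->
  (forall x e, A x -> 0 < e -> exists j, D (v j) x e) ->
  exists u : J -> T, (forall j, A (u j)) /\
    forall x e, A x -> 0 < e -> exists j, D (u j) x e.
Proof.
move=> infJ At0 Dtri Dmono vA.
have [p pP] := surjects_prod infJ (ex_intro _ id (fun y : J => ex_intro _ y erefl))
  (surjects_nat infJ).
(* For each [j] and [n], a point of [A] within [1/(n+1)] of [v j] if there is one, and [t0]
   otherwise. *)
have /choice[w wP] (q : J * nat) : exists t, A t /\
    forall x, A x -> D (v q.1) x (q.2.+1%:R^-1) -> D (v q.1) t (q.2.+1%:R^-1).
  have [[x [Ax Dx]]|nox] := pselect (exists x, A x /\ D (v q.1) x (q.2.+1%:R^-1)).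
    by exists x.
  by exists t0; split=> // x Ax Dx; case: nox; exists x.
exists (w \o p); split=> [j|x e Ax e0]; first by have [] := wP (p j).
have e20 : 0 < e / 2 by rewrite divr_gt0.
have [n] := ltr_add_invr e20; rewrite add0r => ne.
have [j Dj] := vA x n.+1%:R^-1 Ax (ltac:(by rewrite invr_gt0)).
have [i pi] := pP (j, n); exists i; rewrite /= pi.
have [_ /(_ x Ax Dj) Dw] := wP (j, n).
by apply: Dmono (Dtri _ _ _ _ _ Dw Dj); rewrite [e]splitr lerD ?ltW.
Qed.

Definition unif_near (X : Type) (e : R) (f h : X -> X -> R) :=
  forall x y, `|f x y - h x y| <= e.

End Approximation.

Arguments halfn_gt0 R n : clear implicits.
Arguments halfnS R n : clear implicits.

(** * Stages of the tower *)

Section Stage.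
Context {R : realType} {G : topologicalGroupType} (J : Type).
Hypothesis infJ : infinite_set [set: J].

(** The invariants of the tower: functions closed under transposition, finite links and conjugation
    by the group, continuity of the action on points and on functions, and dense families indexed by
    [J], which bound the density of the limit. *)
Record stage := Stage {
  st_T :> Type ;
  st_d : st_T -> st_T -> R ;
  st_G : (st_T -> st_T -> R) -> Prop ;
  st_act : G -> st_T -> st_T ;
  st_pm : pmetric st_d ;
  st_bk : forall f, st_G f -> bikat st_d f ;
  st_tr : forall f, st_G f -> st_G (transp f) ;
  st_link : forall k a b r e, link_ok st_d k a b r e -> st_G (link st_d k a b r e) ;
  st_act1 : forall x, st_act 1%g x = x ;
  st_actM : forall g h x, st_act (g * h)%g x = st_act g (st_act h x) ;
  st_actd : forall g x y, st_d (st_act g x) (st_act g y) = st_d x y ;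
  st_actG : forall g f, st_G f -> st_G (conjf (st_act g^-1%g) f) ;
  st_cont : forall x e, 0 < e -> nbhs (1%g : G) [set g | st_d (st_act g x) x <= e] ;
  st_contG : forall f e, st_G f -> 0 < e ->
    nbhs (1%g : G) [set g | unif_near e (conjf (st_act g^-1%g) f) f] ;
  st_dense : exists u : J -> st_T, forall x e, 0 < e -> exists j, st_d (u j) x <= e ;
  st_denseG : exists u : J -> st_T -> st_T -> R, (forall j, st_G (u j)) /\
    forall f e, st_G f -> 0 < e -> exists j, unif_near e (u j) f }.

Lemma st_Gd (s : stage) : st_G (@st_d s).
Proof.
have [j] := index_inhabited infJ; have [u _] := st_dense s.
rewrite -(link0 (st_pm s) (fun=> u j) (fun=> u j) (fun=> 0)).
by apply: st_link; split=> // *; rewrite lexx.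
Qed.

Section MkStage.
Variables (X : Type) (d : X -> X -> R) (E : (X -> X -> R) -> Prop).
Variable act : G -> X -> X.
Hypothesis dP : pmetric d.
Hypothesis act1 : forall x, act 1%g x = x.
Hypothesis actM : forall g h x, act (g * h)%g x = act g (act h x).
Hypothesis actd : forall g x y, d (act g x) (act g y) = d x y.
Hypothesis cont : forall x e, 0 < e -> nbhs (1%g : G) [set g | d (act g x) x <= e].
Hypothesis dense : exists u : J -> X, forall x e, 0 < e -> exists j, d (u j) x <= e.
Hypothesis Ebk : forall f, E f -> bikat d f.
Hypothesis Etr : forall f, E f -> E (transp f).
Hypothesis EactG : forall g f, E f -> E (conjf (act g^-1%g) f).
Hypothesis EcontG : forall f e, E f -> 0 < e ->
  nbhs (1%g : G) [set g | unif_near e (conjf (act g^-1%g) f) f].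
Hypothesis EdenseG : exists u : J -> X -> X -> R,
  forall f e, E f -> 0 < e -> exists j, unif_near e (u j) f.

(** [E] holds the extensions of functions of the previous stage. Finite links are added afresh at
    every stage, so that every link datum of the limit is available at some finite stage. *)
Let good f := E f \/ exists k a b r e, link_ok d k a b r e /\ f = link d k a b r e.

Let actK g : cancel (act g) (act g^-1%g).
Proof. by move=> x; rewrite -actM mulVg act1. Qed.

Let actVK g : cancel (act g^-1%g) (act g).
Proof. by move=> x; rewrite -actM mulgV act1. Qed.

Let good_bk f : good f -> bikat d f.
Proof. by move=> [/Ebk//|[k [a [b [r [e [ok ->]]]]]]]; exact: link_bikat. Qed.

Let good_tr f : good f -> good (transp f).
Proof.
move=> [/Etr|[k [a [b [r [e [[e0 r0 dr ab ba] ->]]]]]]]; first by left.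
right; exists k, b, a, r, e; rewrite (link_transp dP); split=> //.
by split=> // i ik; rewrite (pmC dP); exact: dr.
Qed.

Let good_link k a b r e : link_ok d k a b r e -> good (link d k a b r e).
Proof. by move=> ok; right; exists k, a, b, r, e. Qed.

Let good_act g f : good f -> good (conjf (act g^-1%g) f).
Proof.
move=> [/EactG|[k [a [b [r [e [[e0 r0 dr ab ba] ->]]]]]]]; first by left.
right; exists k, (act g \o a), (act g \o b), r, e.
rewrite (link_conj dP _ _ _ _ _ (actK g) (actVK g) (actd g)); split=> //.
by split=> //= [i ik|i j ik jk|i j ik jk]; rewrite !actd; [exact: dr|exact: ab|exact: ba].
Qed.

Let near_lt (P : nat -> set G) k : (forall i, nbhs (1%g : G) (P i)) ->
  nbhs (1%g : G) [set g | forall i, (i < k)%N -> P i g].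
Proof.
move=> nP; elim: k => [|k IH]; first exact: nearW.
apply: filterS2 (nP k) IH => g Pk IH i; rewrite ltnS leq_eqVlt => /orP[/eqP->//|].
exact: IH.
Qed.

Let good_cont f e : good f -> 0 < e ->
  nbhs (1%g : G) [set g | unif_near e (conjf (act g^-1%g) f) f].
Proof.
move=> [Ef|[k [a [b [r [e' [[e0 r0 dr ab ba] ->]]]]]]] e_gt0; first exact: EcontG.
have e2 : 0 < e / 2 by rewrite divr_gt0.
have na := near_lt k (fun i => cont (a i) e2).
have nb := near_lt k (fun i => cont (b i) e2).
apply: filterS2 na nb => g ga gb x y.
rewrite (link_conj dP _ _ _ _ _ (actK g) (actVK g) (actd g)).
rewrite ler_distl; apply/andP; split.
- rewrite lerBlDr; apply: link_lip => //; [by rewrite ltW|by rewrite lerDl ltW|].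
  by move=> i ik; have := ga _ ik; have := gb _ ik; have := r0 _ ik => /=; lra.
- apply: link_lip => //; [by rewrite ltW|by rewrite lerDl ltW|] => i ik /=.
  by rewrite !(pmC dP _ (act g _)); have := ga _ ik; have := gb _ ik; have := r0 _ ik => /=; lra.
Qed.


(** A code lists triples of indices, for the two ends and the length of each link, and one index for
    [e]. The coded data may violate [link_ok]; in [good_dense] the functions are replaced by good
    ones nearby. *)
Let link_dense : exists v : J -> X -> X -> R, forall k a b r e eta,
  link_ok d k a b r e -> 0 < eta ->
  exists j, unif_near eta (v j) (link d k a b r e).
Proof.
have [u uP] := dense; have [q qP] := @dense_ge0 R.
have natJ := surjects_nat infJ.
have idJ : surjects J J by exists id => y; exists y.
have [p pP] : surjects J (seq (J * J * nat) * nat).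
  exact: surjects_prod (surjects_seq _ (surjects_prod _ (surjects_prod _ _ _) _)) _.
have [j0] := index_inhabited infJ.
pose lnk (c : seq (J * J * nat) * nat) := let l := nth (j0, j0, 0%N) c.1 in
  link d (size c.1) (fun i => u (l i).1.1) (fun i => u (l i).1.2)
    (fun i => q (l i).2) (q c.2).
exists (fun j => lnk (p j)) => k a b r e eta [e0 r0 _ _ _] eta0.
have eta3 : 0 < eta / 3 by rewrite divr_gt0.
have /choice[ja jaP] i := uP (a i) _ eta3.
have /choice[jb jbP] i := uP (b i) _ eta3.
have /choice[n nP] i : exists n, (i < k)%N -> r i <= q n <= r i + eta / 3.
  have [ik|ik] := pselect (i < k)%N; last by exists 0%N.
  by have [n ?] := qP (r i) _ (r0 _ ik) eta3; exists n.
have [m /andP[em me]] := qP e _ e0 eta3.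
pose s := mkseq (fun i => (ja i, jb i, n i)) k.
have [j pj] := pP (s, m); exists j => x y; rewrite pj /lnk /= size_mkseq.
have nthE i : (i < k)%N -> nth (j0, j0, 0%N) s i = (ja i, jb i, n i).
  exact: nth_mkseq.
rewrite ler_distlC; apply/andP; split.
- rewrite lerBlDr; apply: link_lip => //; [by rewrite ltW|lra|lra|].
  move=> i ik; rewrite nthE //=; have := r0 _ ik; have /andP[? ?] := nP _ ik.
  by rewrite !(pmC dP _ (u _)); have := jaP i; have := jbP i; split; lra.
- apply: link_lip => //; [by rewrite ltW|lra|].
  move=> i ik; rewrite nthE //=; have := r0 _ ik; have /andP[? ?] := nP _ ik.
  by have := jaP i; have := jbP i; split; lra.
Qed.

Let good_d : good d.
Proof.
have [j] := index_inhabited infJ; have [u _] := dense.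
rewrite -(link0 dP (fun=> u j) (fun=> u j) (fun=> 0)).
by apply: good_link; split=> // *; rewrite lexx.
Qed.

Let good_dense : exists u : J -> X -> X -> R, (forall j, good (u j)) /\
  forall f e, good f -> 0 < e -> exists j, unif_near e (u j) f.
Proof.
have [v vP] := link_dense; have [w wP] := EdenseG.
have [p pP] : surjects J (nat * J).
  by apply: surjects_prod (surjects_nat _) _ => //; exists id => y; exists y.
pose c j := if (p j).1 is 0%N then v (p j).2 else w (p j).2.
apply: (dense_subset (D := fun f h e => unif_near e f h) (A := good) (v := c) infJ good_d).
- move=> f h k e e' fh fk x y; have := fh x y; have := fk x y.
  by rewrite !ler_norml => /andP[? ?] /andP[? ?]; apply/andP; split; lra.
- by move=> f h e e' ee' fh x y; exact: le_trans (fh x y) ee'.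
- move=> f e [Ef|[k [a [b [r [e' [ok ->]]]]]]] e0.
    have [j jP] := wP _ _ Ef e0; have [i pi] := pP (1%N, j).
    by exists i; rewrite /c pi.
  have [j jP] := vP _ _ _ _ _ _ ok e0; have [i pi] := pP (0%N, j).
  by exists i; rewrite /c pi.
Qed.

Definition mkstage : stage :=
  Stage dP good_bk good_tr good_link act1 actM actd good_act cont good_cont
    dense good_dense.

Lemma mkstage_extra f : E f -> @st_G mkstage f.
Proof. by left. Qed.

End MkStage.
End Stage.

(** The values below [n] are filled in by [a0]. The induction on [n] shifts the family [A], which
    avoids transporting elements along equalities of indices. *)
Lemma thread_ex (A : nat -> Type) (a0 : forall n, A n) (s : forall n, A n -> A n.+1)
    n (x : A n) :
  exists F : forall N, A N, F n = x /\ forall N, (n <= N)%N -> F N.+1 = s N (F N).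
Proof.
elim: n A a0 s x => [|n IH] A a0 s x.
  by exists (nat_rect A x s).
have [F [Fn Fs]] := IH (fun N => A N.+1) (fun N => a0 N.+1) (fun N => s N.+1) x.
exists (fun N => match N with 0 => a0 0%N | N'.+1 => F N' end); split=> //.
by case=> // N nN; exact: Fs.
Qed.

(** * The successor stage *)

Section Tower.
Context {R : realType} {G : topologicalGroupType} (J : Type).
Hypothesis infJ : infinite_set [set: J].
Notation stage := (@stage R G J).

Lemma st_inhabited (s : stage) : inhabited s.
Proof. by have [j] := index_inhabited infJ; have [u _] := st_dense s; constructor; exact: u j. Qed.

Section Next.
Variable s : stage.
Notation d := (@st_d _ _ _ s).
Notation Good := (@st_G _ _ _ s).
Notation Y := (step Good).
Let Gd : Good d := st_Gd infJ s.
Let dP : pmetric d := st_pm s.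
Let GbkP : forall f, Good f -> bikat d f := @st_bk _ _ _ s.
Let GtrP : forall f, Good f -> Good (transp f) := @st_tr _ _ _ s.

Let actK g : cancel (@st_act _ _ _ s g) (st_act g^-1%g).
Proof. by move=> x; rewrite -st_actM mulVg st_act1. Qed.

Let actVK g : cancel (@st_act _ _ _ s g^-1%g) (st_act g).
Proof. by move=> x; rewrite -st_actM mulgV st_act1. Qed.

Let conjG g (h : {f | Good f}) : {f | Good f} :=
  exist Good _ (st_actG g (svalP h)).

Definition next_act g : Y -> Y := step_act (st_act g) (@st_actG _ _ _ s g).

Definition next_inc : s -> Y := inc Gd.

Definition next_ext (h : {f | Good f}) : Y -> Y -> R := ext Gd GtrP h.

Let E f := exists h, f = next_ext h.

Let nact1 p : next_act 1%g p = p.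
Proof.
case: p => x [f Gf]; congr (_, _); first exact: st_act1.
apply: eq_exist; apply/funext => a; apply/funext => b.
by rewrite /conjf /= invg1 !st_act1.
Qed.

Let nactM g h p : next_act (g * h)%g p = next_act g (next_act h p).
Proof.
case: p => x [f Gf]; congr (_, _); first exact: st_actM.
apply: eq_exist; apply/funext => a; apply/funext => b.
by rewrite /conjf /= invgM !st_actM.
Qed.

Let nactd g p q : sdist d (next_act g p) (next_act g q) = sdist d p q.
Proof. by apply: step_act_isometry; [exact: dP|exact: GbkP|exact: actK|exact: st_actd]. Qed.

Let ncont p e : 0 < e -> nbhs (1%g : G) [set g | sdist d (next_act g p) p <= e].
Proof.
move=> e0; have e2 : 0 < e / 2 by rewrite divr_gt0.
apply: filterS2 (st_cont p.1 e2) (st_contG (svalP p.2) e2) => g /= gx gf.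
by apply: le_trans (sdist_le2 dP (p := next_act g p) (q := p) gf) _; move: gx => /=; lra.
Qed.

Let ndense : exists u : J -> Y, forall x e, 0 < e -> exists j, sdist d (u j) x <= e.
Proof.
have [u uP] := st_dense s; have [v [vG vP]] := st_denseG s.
have [p pP] := surjects_square infJ.
exists (fun j => (u (p j).1, exist Good _ (vG (p j).2))) => -[x [f Gf]] e e0.
have e2 : 0 < e / 2 by rewrite divr_gt0.
have [i iP] := uP x _ e2; have [i' i'P] := vP _ _ Gf e2.
have [j pj] := pP (i, i'); exists j; apply: le_trans (sdist_le2 dP (e := e / 2) _) _.
  by rewrite /= pj.
by rewrite /= pj /=; lra.
Qed.

Let nextact_ext g h : conjf (next_act g^-1%g) (next_ext h) = next_ext (conjG g h).
Proof.
have K p : next_act g (next_act g^-1%g p) = p by rewrite -nactM mulgV nact1.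
apply/funext => p; apply/funext => q; apply/eqP; rewrite /conjf eq_le.
apply/andP; split; last first.
  rewrite -[in X in X <= _](K p) -[in X in X <= _](K q).
  by apply: step_act_ext; [exact: dP|exact: GbkP|exact: actK|exact: actVK|exact: st_actd].
have hK : conjG g^-1%g (conjG g h) = h.
  case: h => f Gf; apply: eq_exist; apply/funext => a; apply/funext => b.
  by rewrite /conjf /= /conjf invgK !actK.
rewrite -{1}hK; apply: step_act_ext; [exact: dP|exact: GbkP|exact: actK| |exact: st_actd].
by rewrite invgK => ?; exact: actK.
Qed.

Let Ebk f : E f -> bikat (@sdist _ _ d Good) f.
Proof. by move=> [h ->]; exact: ext_bikat. Qed.

Let Etr f : E f -> E (transp f).
Proof.
move=> [h ->]; exists (trG GtrP h); apply/funext => p; apply/funext => q.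
by rewrite /transp /next_ext ext_tr.
Qed.

Let EactG g f : E f -> E (conjf (next_act g^-1%g) f).
Proof. by move=> [h ->]; exists (conjG g h); exact: nextact_ext. Qed.

Let EcontG f e : E f -> 0 < e ->
  nbhs (1%g : G) [set g | unif_near e (conjf (next_act g^-1%g) f) f].
Proof.
move=> [h ->] e0; apply: filterS (st_contG (svalP h) e0) => g gh p q.
by rewrite nextact_ext; exact: ext_lip.
Qed.

Let EdenseG : exists u : J -> Y -> Y -> R,
  forall f e, E f -> 0 < e -> exists j, unif_near e (u j) f.
Proof.
have [v [vG vP]] := st_denseG s.
exists (fun j => next_ext (exist Good _ (vG j))) => _ e [[f Gf] ->] e0.
by have [j jP] := vP _ _ Gf e0; exists j; exact: ext_lip.
Qed.

Definition next : stage := mkstage infJ (sdist_pm dP GbkP) nact1 nactM nactd ncont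
  ndense Ebk Etr EactG EcontG EdenseG.

Lemma next_extG (h : {f | Good f}) : @st_G _ _ _ next (next_ext h).
Proof. by apply: mkstage_extra; exists h. Qed.

Lemma next_act_inc g x : next_act g (next_inc x) = next_inc (st_act g x).
Proof. by apply: step_act_inc; [exact: actVK|exact: st_actd]. Qed.

End Next.
End Tower.

(** * The direct limit and its isometries *)

Section Limit.
Context {R : realType} {G : topologicalGroupType} (J : Type).
Hypothesis infJ : infinite_set [set: J].
Variable s0 : @stage R G J.

Fixpoint tower n : stage J := if n is n'.+1 then next infJ (tower n') else s0.

Definition cross n := {f | @st_G _ _ _ (tower n) f}.

Definition tinc n : tower n -> tower n.+1 := @next_inc _ _ _ infJ (tower n).

Definition text n (h : cross n) : cross n.+1 := exist _ _ (next_extG infJ h).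

Let tP n := st_pm (tower n).
Let tbk n := @st_bk _ _ _ (tower n).

Let tinc_d n (x y : tower n) : st_d (tinc x) (tinc y) = st_d x y.
Proof. by apply: sdist_inc2; [exact: tP|exact: tbk]. Qed.

Let tinc_act n g (x : tower n) : st_act g (tinc x) = tinc (st_act g x).
Proof. exact: next_act_inc. Qed.

Let text_inc n (h : cross n) x y : sval (text h) (tinc x) (tinc y) = sval h x y.
Proof. by apply: ext_inc; [exact: tP|exact: tbk]. Qed.

Let text_zerol n (h : cross n) x : exists y, sval (text h) (tinc x) y = 0.
Proof. by exists (x, h); apply: ext_zerol; [exact: tP|exact: tbk]. Qed.

Let text_zeror n (h : cross n) x : exists y, sval (text h) y (tinc x) = 0.
Proof.
by exists (x, trG (@st_tr _ _ _ (tower n)) h); apply: ext_zeror; [exact: tP|exact: tbk].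
Qed.

Let text_near n (h : cross n) e :
  unif_near e (sval h) (@st_d _ _ _ (tower n)) ->
  unif_near e (sval (text h)) (@st_d _ _ _ (tower n.+1)).
Proof. by move=> he; apply: ext_near; [exact: tP|exact: tbk|exact: he]. Qed.

(* Points of the direct limit, represented by threads of the tower. *)
Record lim_pt := LimPt {
  lev : nat ;
  thr :> forall N, tower N ;
  thrP : forall N, (lev <= N)%N -> thr N.+1 = tinc (thr N) }.

(** Only a pseudometric: threads that agree from some level on are at distance [0], and are
    identified in the completion. *)
Definition ldist (x y : lim_pt) : R :=
  let N := maxn (lev x) (lev y) in st_d (x N) (y N).

Lemma ldistE N (x y : lim_pt) : (lev x <= N)%N -> (lev y <= N)%N ->
  ldist x y = st_d (x N) (y N).
Proof.
move=> xN yN; have : (maxn (lev x) (lev y) <= N)%N by rewrite geq_max xN.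
move=> /subnK <-; elim: (N - _)%N => [//|k ->].
by rewrite addSn !thrP ?tinc_d// (leq_trans _ (leq_addl _ _))// ?leq_maxl ?leq_maxr.
Qed.

Let lev3 (x y z : lim_pt) : exists N, [/\ (lev x <= N)%N, (lev y <= N)%N & (lev z <= N)%N].
Proof.
exists (maxn (lev x) (maxn (lev y) (lev z))).
by rewrite !leq_max !leqnn !orbT.
Qed.

Lemma ldist_pm : pmetric ldist.
Proof.
split=> [x|x y|x y z|x y].
- exact: pm0 (tP _) _.
- by have [N [xN yN _]] := lev3 x y x; rewrite !(ldistE (N := N))// (pmC (tP N)).
- by have [N [xN yN zN]] := lev3 x y z; rewrite !(ldistE (N := N))//; exact: pmD (tP N) _ _ _.
- exact: pm_le1 (tP _) _ _.
Qed.

Lemma lim_pt_ex n (x : tower n) : exists p : lim_pt, (lev p <= n)%N /\ p n = x.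
Proof.
have [t] := st_inhabited infJ s0.
have [F [Fn FS]] := thread_ex (nat_rect (fun n => tower n) t (fun n => @tinc n)) tinc x.
by exists (LimPt FS).
Qed.

Lemma lim_pt_eq (p q : lim_pt) : lev p = lev q -> (forall N, p N = q N) -> p = q.
Proof.
case: p q => [l p pP] [l' q qP] /= ll' pq; rewrite -{}ll' in qP *.
have {}pq : p = q by apply: functional_extensionality_dep.
by rewrite -{}pq in qP *; congr LimPt; exact: Prop_irrelevance.
Qed.

Definition lact g (p : lim_pt) : lim_pt :=
  @LimPt (lev p) (fun N => st_act g (p N))
    (fun N pN => etrans (congr1 (st_act g) (thrP pN)) (tinc_act g (p N))).

Lemma lact1 p : lact 1%g p = p.
Proof. by apply: lim_pt_eq => // N; exact: st_act1. Qed.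

Lemma lactM g h p : lact (g * h)%g p = lact g (lact h p).
Proof. by apply: lim_pt_eq => // N; exact: st_actM. Qed.

Lemma lactd g p q : ldist (lact g p) (lact g q) = ldist p q.
Proof. exact: st_actd. Qed.

Lemma lcont p e : 0 < e -> nbhs (1%g : G) [set g | ldist (lact g p) p <= e].
Proof. by move=> e0; rewrite /ldist /=; exact: st_cont. Qed.

Lemma ldense : exists u : J -> lim_pt,
  forall p e, 0 < e -> exists j, ldist (u j) p <= e.
Proof.
pose u n := sval (cid (st_dense (tower n))).
have uP n := svalP (cid (st_dense (tower n))).
have /choice[v vP] (q : nat * J) := lim_pt_ex (u q.1 q.2).
have [f fP] : surjects J (nat * J).
  by apply: surjects_prod (surjects_nat _) _ => //; exists id => y; exists y.
exists (v \o f) => p e e0; have [j uj] := uP (lev p) (p (lev p)) _ e0; rewrite -/(u _) in uj.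
have [i fi] := fP (lev p, j); exists i; rewrite /= fi.
by have [vl vE] := vP (lev p, j); rewrite (ldistE (N := lev p))// vE.
Qed.

Section LimCross.
Variables (n : nat) (Phi : forall N, cross N).
Hypothesis PhiS : forall N, (n <= N)%N -> Phi N.+1 = text (Phi N).

Definition lcross (x y : lim_pt) : R :=
  let N := maxn n (maxn (lev x) (lev y)) in sval (Phi N) (x N) (y N).

Lemma lcrossE N (x y : lim_pt) : (n <= N)%N -> (lev x <= N)%N -> (lev y <= N)%N ->
  lcross x y = sval (Phi N) (x N) (y N).
Proof.
move=> nN xN yN; have : (maxn n (maxn (lev x) (lev y)) <= N)%N by rewrite !geq_max nN xN.
move=> /subnK <-; elim: (N - _)%N => [//|k ->].
rewrite addSn PhiS ?thrP ?text_inc// (leq_trans _ (leq_addl _ _))// !leq_max leqnn ?orbT//.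
Qed.

Let lev3n (x y z : lim_pt) :
  exists N, [/\ (n <= N)%N, (lev x <= N)%N, (lev y <= N)%N & (lev z <= N)%N].
Proof.
have [N [xN yN zN]] := lev3 x y z; exists (maxn n N).
by rewrite leq_maxl !leq_max xN yN zN !orbT.
Qed.

Lemma lcross_bikat : bikat ldist lcross.
Proof.
have bk N := tbk (svalP (Phi N)).
split=> [x y|x y|x y z|x y z|x y z|x y z].
- exact: bk_ge0 (bk _) _ _.
- exact: bk_le1 (bk _) _ _.
- have [N [nN xN yN zN]] := lev3n x y z; rewrite !(lcrossE (N := N))// (ldistE (N := N))//.
  exact: bk_lipl (bk N) _ _ _.
- have [N [nN xN yN zN]] := lev3n x y z; rewrite !(lcrossE (N := N))// (ldistE (N := N))//.
  exact: bk_lipr (bk N) _ _ _.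
- have [N [nN xN yN zN]] := lev3n x y z; rewrite !(lcrossE (N := N))// (ldistE (N := N))//.
  exact: bk_dl (bk N) _ _ _.
- have [N [nN xN yN zN]] := lev3n x y z; rewrite !(lcrossE (N := N))// (ldistE (N := N))//.
  exact: bk_dr (bk N) _ _ _.
Qed.

(** The missing image of [x] is adjoined one stage later, as the pair of [x N] and [Phi N]. *)
Lemma lcross_zerol x : exists y, lcross x y = 0.
Proof.
have [N [nN xN _ _]] := lev3n x x x.
have [y y0] := text_zerol (Phi N) (x N); have [p [pl pE]] := lim_pt_ex y.
by exists p; rewrite (lcrossE (N := N.+1)) ?(leqW nN) ?(leqW xN)// PhiS// (thrP xN) pE.
Qed.

Lemma lcross_zeror x : exists y, lcross y x = 0.
Proof.
have [N [nN xN _ _]] := lev3n x x x.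
have [y y0] := text_zeror (Phi N) (x N); have [p [pl pE]] := lim_pt_ex y.
by exists p; rewrite (lcrossE (N := N.+1)) ?(leqW nN) ?(leqW xN)// PhiS// (thrP xN) pE.
Qed.

Lemma lcross_near e : unif_near e (sval (Phi n)) (@st_d _ _ _ (tower n)) ->
  unif_near e lcross ldist.
Proof.
move=> ne x y; have [N [nN xN yN _]] := lev3n x y x.
rewrite (lcrossE (N := N))// (ldistE (N := N))//.
suff : unif_near e (sval (Phi N)) (@st_d _ _ _ (tower N)) by apply.
rewrite -(subnK nN); elim: (N - n)%N => [//|k IH].
by rewrite addSn PhiS ?leq_addl//; exact: text_near.
Qed.

End LimCross.

Lemma cross_thread n (f : cross n) : exists Phi : forall N, cross N,
  Phi n = f /\ forall N, (n <= N)%N -> Phi N.+1 = text (Phi N).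
Proof.
exact: (thread_ex (fun N => exist _ _ (st_Gd infJ (tower N))) text).
Qed.

(** The finitely many ends live at a common stage [n]. The linked function there extends along the
    tower to a bikat function of the limit, whose zeros on rows and columns define [u] and [v]. *)
Lemma lim_isometry k a b r e : link_ok ldist k a b r e ->
  exists u v : lim_pt -> lim_pt,
  [/\ (forall x y, ldist (u x) (u y) = ldist x y) /\
       (forall x y, ldist (v x) (v y) = ldist x y),
      (forall x, ldist (v (u x)) x = 0) /\ (forall y, ldist (u (v y)) y = 0),
      (forall x, ldist (u x) x <= e),
      (forall i, (i < k)%N -> ldist (u (a i)) (b i) <= r i) &
      forall i j c, (i < k)%N -> (j < k)%N -> c <= 1 ->
        c <= ldist (a i) (b j) + e ->
        (forall l, (l < k)%N -> c <= ldist (a i) (a l) + r l + ldist (b l) (b j)) ->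
        c <= ldist (u (a i)) (b j)].
Proof.
move=> [e0 r0 dr ab ba].
pose n := (\max_(i < k) maxn (lev (a i)) (lev (b i)))%N.
have an i : (i < k)%N -> (lev (a i) <= n)%N.
  move=> ik; apply: leq_trans (leq_bigmax (Ordinal ik)); exact: leq_maxl.
have bn i : (i < k)%N -> (lev (b i) <= n)%N.
  move=> ik; apply: leq_trans (leq_bigmax (Ordinal ik)); exact: leq_maxr.
pose an' i := a i n; pose bn' i := b i n.
have ok : link_ok (@st_d _ _ _ (tower n)) k an' bn' r e.
  split=> // [i ik|i j ik jk|i j ik jk].
  - by rewrite -ldistE ?an ?bn//; exact: dr.
  - by rewrite -!ldistE ?an ?bn//; exact: ab.
  - by rewrite -!ldistE ?an ?bn//; exact: ba.
have [Phi [Phin PhiS]] := cross_thread (exist _ _ (st_link ok)).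
pose phi := lcross n Phi.
have phiP : bikat ldist phi := lcross_bikat PhiS.
have dP := ldist_pm.
have near : unif_near e phi ldist.
  by apply: lcross_near => //; rewrite Phin; exact: link_near (tP n) ok.
have /choice[u u0] x : exists y, phi x y = 0 := lcross_zerol PhiS x.
have /choice[v v0] x : exists y, phi y x = 0 := lcross_zeror PhiS x.
(* As [phi x] vanishes at [u x], the inequalities of a bikat function squeeze [phi x y] to the
   distance from [u x] to [y]. *)
have uE x y : ldist (u x) y = phi x y.
  apply/eqP; rewrite eq_le; apply/andP; split.
    by have := bk_dr phiP x (u x) y; rewrite u0 add0r.
  by have := bk_lipr phiP x y (u x); rewrite u0 add0r.
have phiE i j : (i < k)%N -> (j < k)%N ->
    phi (a i) (b j) = link (@st_d _ _ _ (tower n)) k an' bn' r e (an' i) (bn' j).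
  by move=> ik jk; rewrite /phi (lcrossE PhiS (N := n)) ?an ?bn// Phin.
have uv y : ldist (u (v y)) y = 0 by rewrite uE v0.
have ud x y : ldist (u x) (u y) = ldist x y.
  rewrite uE; apply/eqP; rewrite eq_le; apply/andP; split.
    by have := bk_lipl phiP x y (u y); rewrite u0 addr0.
  by have := bk_dl phiP x y (u y); rewrite u0 addr0.
exists u, v; split.
- split=> // x y; rewrite -ud.
  have := pmD dP (u (v x)) x (u (v y)); have := pmD dP x y (u (v y)).
  have := pmD dP x (u (v x)) y; have := pmD dP (u (v x)) (u (v y)) y.
  rewrite (pmC dP x (u (v x))) (pmC dP y (u (v y))) !uv => *.
  by apply/eqP; rewrite eq_le; apply/andP; split; lra.
- split=> // x; apply/eqP; rewrite eq_le pm_ge0// andbT.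
  by have := bk_dl phiP (v (u x)) x (u x); rewrite (u0 x) (v0 (u x)) addr0.
- by move=> x; rewrite uE; have := near x x; rewrite (pm0 dP) subr0; exact: le_trans (ler_norm _).
- move=> i ik; rewrite uE phiE//; apply: glue_le0; [exact: tP|exact: r0|].
  by right; exists i.
(* At the linked points the value is the explicit infimum of stage [n], so the lower bound is
   checked link by link. *)
- move=> i j c ik jk c1 ce cl; rewrite uE phiE//; apply: le_glue => //.
  move=> p q l l0 [[<- ->]|[m mk [-> -> ->]]].
    have := pmD (tP n) (an' i) p (bn' j).
    by move: ce; rewrite (ldistE (N := n)) ?an ?bn// -/(an' i) -/(bn' j); lra.
  by have := cl _ mk; rewrite !(ldistE (N := n)) ?an ?bn.
Qed.

End Limit.

(** * Completion *)

Section Completion.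
Context {R : realType}.
Variables (X : Type) (d : X -> X -> R) (dP : pmetric d).

(** Points of the completion are the uniform limits of distance functions [d x], as in the
    Kuratowski embedding. *)
Definition adherent (f : X -> R) :=
  forall e, 0 < e -> exists x, forall y, `|f y - d x y| <= e.

(** The proof is an argument of the type, so that the metric structure, which depends on it, can be
    inferred. *)
Definition completion of pmetric d := {f | adherent f}.

Notation M := (completion dP).
Implicit Types (f g h : M) (x y z : X).

Definition cfun f : X -> R := sval f.

Lemma cfun_inj f g : (forall y, cfun f y = cfun g y) -> f = g.
Proof. by case: f g => f fP [g gP] /= fg; apply: eq_exist; exact/funext. Qed.

Lemma cfun_lip f y z : `|cfun f y - cfun f z| <= d y z.
Proof.
apply/ler_addgt0Pr => e e0; have [|x fx] := svalP f (e / 2); first by rewrite divr_gt0.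
have := fx y; have := fx z; rewrite !ler_norml -/(cfun f).
have := pmD dP x y z; have := pmD dP x z y; rewrite (pmC dP z y).
by move=> ? ? /andP[? ?] /andP[? ?]; apply/andP; split; lra.
Qed.

Lemma cfun_eq f y z : d y z = 0 -> cfun f y = cfun f z.
Proof. by move=> yz; apply/eqP; rewrite -subr_eq0 -normr_le0 -yz cfun_lip. Qed.

Lemma cfun_ge0 f y : 0 <= cfun f y.
Proof.
apply/ler_addgt0Pr => e e0; have [x /(_ y)] := svalP f e e0.
by rewrite ler_norml -/(cfun f); have := pm_ge0 x y dP; lra.
Qed.

Lemma cfun_le1 f y : cfun f y <= 1.
Proof.
apply/ler_addgt0Pr => e e0; have [x /(_ y)] := svalP f e e0.
by rewrite ler_norml -/(cfun f); have := pm_le1 dP x y; lra.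
Qed.

Definition cdist f g : R := inf1 (fun e => forall y, `|cfun f y - cfun g y| <= e).

Lemma cdist_ge f g y : `|cfun f y - cfun g y| <= cdist f g.
Proof.
apply: le_inf1 => [|e e0 fg]; last exact: fg.
have := cfun_ge0 f y; have := cfun_ge0 g y; have := cfun_le1 f y; have := cfun_le1 g y.
by rewrite ler_norml => *; apply/andP; split; lra.
Qed.

Lemma cdist_le f g e : 0 <= e -> (forall y, `|cfun f y - cfun g y| <= e) -> cdist f g <= e.
Proof. by move=> e0 fg; exact: inf1_le. Qed.

Let cdistxx f : cdist f f = 0.
Proof.
by apply/eqP; rewrite eq_le inf1_ge0 cdist_le// => y; rewrite subrr normr0.
Qed.

Let cdist_eq f g : cdist f g = 0 -> f = g.
Proof.
move=> fg; apply: cfun_inj => y; apply/eqP.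
by rewrite -subr_eq0 -normr_le0 -fg cdist_ge.
Qed.

Let cdistC f g : cdist f g = cdist g f.
Proof.
suff le f' g' : cdist f' g' <= cdist g' f' by apply/eqP; rewrite eq_le !le.
by apply: cdist_le => [|y]; [exact: inf1_ge0|rewrite distrC cdist_ge].
Qed.

Let cdist_triangle g f h : cdist f h <= cdist f g + cdist g h.
Proof.
apply: cdist_le => [|y]; first by rewrite addr_ge0// inf1_ge0.
by rewrite (le_trans (ler_distD (cfun g y) _ _))// lerD// cdist_ge.
Qed.

HB.instance Definition _ := gen_eqMixin M.
HB.instance Definition _ := gen_choiceMixin M.
HB.instance Definition _ := isMetric.Build R M cdistxx cdist_eq cdistC cdist_triangle.

Fact cinc_adh x : adherent (d x).
Proof. by move=> e e0; exists x => y; rewrite subrr normr0 ltW. Qed.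

Definition cinc x : M := exist adherent (d x) (cinc_adh x).

Lemma mdist_cinc x f : mdist (cinc x) f = cfun f x.
Proof.
apply/eqP; rewrite eq_le; apply/andP; split; last first.
  have := cdist_ge (cinc x) f x; rewrite /= (pm0 dP) sub0r normrN.
  by rewrite ger0_norm// cfun_ge0.
apply: cdist_le => [|y]; first exact: cfun_ge0.
apply/ler_addgt0Pr => e e0; have [|z fz] := svalP f (e / 2); first by rewrite divr_gt0.
have := fz x; have := fz y; rewrite !ler_norml -/(cfun f) /=.
have := pmD dP x z y; have := pmD dP z x y; rewrite (pmC dP x z).
by move=> ? ? /andP[? ?] /andP[? ?]; apply/andP; split; lra.
Qed.

Lemma mdist_cinc2 x y : mdist (cinc x) (cinc y) = d x y.
Proof. by rewrite mdist_cinc /= (pmC dP). Qed.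

Lemma cinc_dense f e : 0 < e -> exists x, mdist (cinc x) f <= e.
Proof.
move=> e0; have [x fx] := svalP f e e0; exists x; apply: cdist_le; first exact: ltW.
by move=> y; rewrite distrC; exact: fx.
Qed.

Lemma mdist_completion_le1 f g : mdist f g <= 1.
Proof. exact: inf1_le1. Qed.

Lemma completion_complete : complete_metric M.
Proof.
move=> F FF /cauchyP FC.
(* [sup (S y)] is the lower limit along [F] of the values at [y]; this gives the limit without
   choosing a sequence in the filter. *)
pose S y := [set r | F [set f | r <= cfun f y]].
have lP e g : F (ball g e) -> forall y, `|sup (S y) - cfun g y| <= e.
  move=> Fg y.
  have Sge : S y (cfun g y - e).
    apply: filterS Fg => f; rewrite ballEmdist /= => gf.
    have := cdist_ge g f y; rewrite ler_norml => /andP[_ le].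
    by rewrite lerBlDr -lerBlDl; exact: le_trans le (ltW gf).
  have Sub : ubound (S y) (cfun g y + e).
    move=> r Sr; have [f [/= rf]] := filter_ex (filterI Sr Fg).
    rewrite ballEmdist /= => gf; have := cdist_ge g f y; rewrite distrC ler_norml => /andP[_ le].
    by apply: le_trans rf _; rewrite -lerBlDl; exact: le_trans le (ltW gf).
  have hS : has_sup (S y) by split; [exists (cfun g y - e)|exists (cfun g y + e)].
  rewrite ler_norml; apply/andP; split.
    by rewrite lerBrDr addrC; apply: ub_le_sup => //; case: hS.
  by rewrite lerBlDl; apply: ge_sup => //; case: hS.
have ladh : adherent (fun y => sup (S y)).
  move=> e e0; have e2 : 0 < e / 2 by rewrite divr_gt0.
  have [g Fg] := FC _ e2; have [x gx] := svalP g _ e2.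
  exists x => y; rewrite [e]splitr (le_trans (ler_distD (cfun g y) _ _))//.
  by apply: lerD; [exact: lP|exact: gx].
exists (exist _ _ ladh); apply/metricType_numDomainType.fcvgrPdist_lt => e e0.
have e3 : 0 < e / 3 by rewrite divr_gt0.
have [g Fg] := FC _ e3; have lg := lP _ _ Fg; apply: filterS Fg => f gf.
rewrite (le_lt_trans (metric_triangle _ g _))//.
have : mdist (exist _ _ ladh : M) g <= e / 3.
  by apply: cdist_le => [|y]; [exact: ltW|exact: lg].
by move: gf; rewrite ballEmdist /=; lra.
Qed.

Section Lift.
Variables u v : X -> X.
Hypotheses (ud : forall x y, d (u x) (u y) = d x y).
Hypotheses (vd : forall x y, d (v x) (v y) = d x y).
Hypotheses (vu : forall x, d (v (u x)) x = 0) (uv : forall y, d (u (v y)) y = 0).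

Let uvd x y : d x (v y) = d (u x) y.
Proof.
have := pmD dP (u x) (u (v y)) y; have := pmD dP (u x) y (u (v y)).
rewrite (pmC dP y (u (v y))) uv ud => *.
by apply/eqP; rewrite eq_le; apply/andP; split; lra.
Qed.

Let lift_adh (f : M) : adherent (cfun f \o v).
Proof.
move=> e e0; have [x fx] := svalP f e e0.
by exists (u x) => y /=; rewrite -uvd; exact: fx.
Qed.

(** In terms of distance functions, applying [u] is composing with its inverse [v]. *)
Definition lift_fun (f : M) : M := exist _ _ (lift_adh f).

Fact lift_isometric : isometric_on [set: M] lift_fun.
Proof.
move=> f g _ _; apply/eqP; rewrite eq_le; apply/andP; split.
  by apply: cdist_le => [|y]; [exact: inf1_ge0|exact: (cdist_ge f g (v y))].
apply: cdist_le => [|y]; first exact: inf1_ge0.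
by rewrite -(cfun_eq f (vu y)) -(cfun_eq g (vu y)); exact: (cdist_ge (lift_fun f) (lift_fun g) (u y)).
Qed.

End Lift.

Definition lift (u v : X -> X) (ud : forall x y, d (u x) (u y) = d x y)
    (vd : forall x y, d (v x) (v y) = d x y) (vu : forall x, d (v (u x)) x = 0)
    (uv : forall y, d (u (v y)) y = 0) : Iso M.
Proof.
apply: (MkIso (lift_isometric ud vu uv)) => f.
exists (lift_fun vd vu f); apply: cfun_inj => y.
by rewrite /= (cfun_eq f (uv y)).
Defined.

Lemma liftE u v ud vd vu uv f y : cfun (@lift u v ud vd vu uv f) y = cfun f (v y).
Proof. by []. Qed.

Lemma lift_cinc u v ud vd vu uv x : @lift u v ud vd vu uv (cinc x) = cinc (u x).
Proof.
apply: cfun_inj => y; rewrite liftE /=.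
have := pmD dP (u x) (u (v y)) y; have := pmD dP (u x) y (u (v y)).
rewrite (pmC dP y (u (v y))) uv ud => *.
by apply/eqP; rewrite eq_le; apply/andP; split; lra.
Qed.

Lemma lift_near u v ud vd vu uv e : (forall x, d (u x) x <= e) ->
  forall f, mdist (@lift u v ud vd vu uv f) f <= e.
Proof.
move=> ue f; have [x _] := svalP f 1 ltr01.
have e0 : 0 <= e by exact: le_trans (pm_ge0 _ _ dP) (ue x).
apply: cdist_le => // y; rewrite liftE (le_trans (cfun_lip _ _ _))//.
apply: le_trans (ue (v y)); have := pmD dP (v y) (u (v y)) y.
by rewrite uv addr0 (pmC dP (v y) (u _)).
Qed.

Section Linkable.

(* [u] is an isometry of [X] up to distance [0], with inverse [v]; the last
   clause says that [u (a i)] is as far from [b j] as the links and the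
   truncation of distances at [1] allow. *)
Definition linkable := forall k a b r e, link_ok d k a b r e ->
  exists u v : X -> X,
  [/\ (forall x y, d (u x) (u y) = d x y) /\
       (forall x y, d (v x) (v y) = d x y),
      (forall x, d (v (u x)) x = 0) /\ (forall y, d (u (v y)) y = 0),
      (forall x, d (u x) x <= e),
      (forall i, (i < k)%N -> d (u (a i)) (b i) <= r i) &
      forall i j c, (i < k)%N -> (j < k)%N -> c <= 1 ->
        c <= d (a i) (b j) + e ->
        (forall l, (l < k)%N -> c <= d (a i) (a l) + r l + d (b l) (b j)) ->
        c <= d (u (a i)) (b j)].

Hypothesis dL : linkable.

(** Points of [X] within [r / 4] of the given ones satisfy the link conditions with lengths [r / 2],
    and the edges of length [e] bound the displacement. The errors [r / 4], [r / 2], [r / 4] add up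
    to [r]. *)
Lemma approx_homogeneous k (a b : nat -> M) e r : 0 <= e -> 0 < r ->
  (forall i, (i < k)%N -> mdist (a i) (b i) <= e) ->
  (forall i j, (i < k)%N -> (j < k)%N -> mdist (a i) (a j) = mdist (b i) (b j)) ->
  exists U : Iso M, (forall f, mdist (U f) f <= e) /\
    forall i, (i < k)%N -> mdist (U (a i)) (b i) <= r.
Proof.
move=> e0 r0 abe abd; have r4 : 0 < r / 4 by rewrite divr_gt0.
have /choice[a' a'P] i := cinc_dense (a i) r4.
have /choice[b' b'P] i := cinc_dense (b i) r4.
have a'd i j : `|d (a' i) (a' j) - mdist (a i) (a j)| <= r / 2.
  rewrite -mdist_cinc2.
  have := metric_triangle (cinc (a' i)) (a i) (cinc (a' j)).
  have := metric_triangle (a i) (a j) (cinc (a' j)).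
  have := metric_triangle (a i) (cinc (a' i)) (a j).
  have := metric_triangle (cinc (a' i)) (cinc (a' j)) (a j).
  rewrite (metric_sym (a j)) (metric_sym (a i) (cinc (a' i))).
  by have := a'P i; have := a'P j => *; rewrite ler_norml; apply/andP; split; lra.
have b'd i j : `|d (b' i) (b' j) - mdist (b i) (b j)| <= r / 2.
  rewrite -mdist_cinc2.
  have := metric_triangle (cinc (b' i)) (b i) (cinc (b' j)).
  have := metric_triangle (b i) (b j) (cinc (b' j)).
  have := metric_triangle (b i) (cinc (b' i)) (b j).
  have := metric_triangle (cinc (b' i)) (cinc (b' j)) (b j).
  rewrite (metric_sym (b j)) (metric_sym (b i) (cinc (b' i))).
  by have := b'P i; have := b'P j => *; rewrite ler_norml; apply/andP; split; lra.
have ok : link_ok d k a' b' (fun=> r / 2) e.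
  split=> // [i _|i ik|i j ik jk|i j ik jk]; first by rewrite divr_ge0// ltW.
  - rewrite -mdist_cinc2; have := metric_triangle (cinc (a' i)) (a i) (cinc (b' i)).
    have := metric_triangle (a i) (b i) (cinc (b' i)); rewrite (metric_sym (b i)).
    by have := a'P i; have := b'P i; have := abe _ ik; lra.
  - have := a'd i j; have := b'd i j; rewrite (abd _ _ ik jk) !ler_norml.
    by move=> /andP[? ?] /andP[? ?]; lra.
  - have := a'd i j; have := b'd i j; rewrite (abd _ _ ik jk) !ler_norml.
    by move=> /andP[? ?] /andP[? ?]; lra.
have [u [v [[ud vd] [vu uv] ue uab _]]] := dL ok.
exists (lift ud vd vu uv); split=> [f|i ik]; first exact: lift_near.
have := metric_triangle (lift ud vd vu uv (a i)) (cinc (u (a' i))) (b i).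
have := metric_triangle (cinc (u (a' i))) (cinc (b' i)) (b i).
have -> : mdist (lift ud vd vu uv (a i)) (cinc (u (a' i))) = mdist (cinc (a' i)) (a i).
  by rewrite -(lift_cinc ud vd vu uv) Iso_isometric// metric_sym.
rewrite mdist_cinc2.
by have := a'P i; have := b'P i; have := uab _ ik; lra.
Qed.

(** All links start at one point [x0], whose image is the new point; the consistency of such links
    is the bound on [mdist (m i) (m j)]. *)
Lemma approx_extension (m0 : M) k (m : nat -> M) (rho : nat -> R) delta :
  0 < delta -> (forall i, (i < k)%N -> 0 <= rho i) ->
  (forall i j, (i < k)%N -> (j < k)%N -> mdist (m i) (m j) <= rho i + rho j) ->
  exists p : M, forall j, (j < k)%N -> mdist p (m j) <= rho j + delta /\
    forall c, c <= 1 -> (forall i, (i < k)%N -> c <= rho i + mdist (m i) (m j)) ->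
      c - delta <= mdist p (m j).
Proof.
move=> delta0 rho0 rhom; set eta := delta / 4.
have eta0 : 0 < eta by rewrite divr_gt0.
have [x0 _] := cinc_dense m0 ltr01.
have /choice[x xP] i := cinc_dense (m i) eta0.
have xd i j : `|d (x i) (x j) - mdist (m i) (m j)| <= eta + eta.
  rewrite -mdist_cinc2.
  have := metric_triangle (cinc (x i)) (m i) (cinc (x j)).
  have := metric_triangle (m i) (m j) (cinc (x j)).
  have := metric_triangle (m i) (cinc (x i)) (m j).
  have := metric_triangle (cinc (x i)) (cinc (x j)) (m j).
  rewrite (metric_sym (m j)) (metric_sym (m i) (cinc (x i))).
  by have := xP i; have := xP j => *; rewrite ler_norml; apply/andP; split; lra.
(* With [e = 1] the edges from points to their copies impose nothing, distances being at most [1];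
   the padding [eta] absorbs the approximation of each [m i]. *)
have ok : link_ok d k (fun=> x0) x (fun i => rho i + eta) 1.
  split=> // [i ik|i ik|i j ik jk|i j ik jk].
  - by have := rho0 _ ik; lra.
  - by have := rho0 _ ik; have := pm_le1 dP x0 (x i); lra.
  - rewrite (pm0 dP); have := pm_ge0 (x i) (x j) dP.
    by have := rho0 _ ik; have := rho0 _ jk; lra.
  - rewrite (pm0 dP); have := rhom _ _ ik jk.
    by have := xd i j; rewrite ler_norml => /andP[? ?]; lra.
have [u [v [_ _ _ uab ulow]]] := dL ok.
exists (cinc (u x0)) => j jk.
have le1 := metric_triangle (cinc (u x0)) (cinc (x j)) (m j).
have le2 := metric_triangle (cinc (u x0)) (m j) (cinc (x j)).
rewrite (metric_sym (m j)) !mdist_cinc2 in le1 le2.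
split; first by have := xP j; have := uab _ jk; rewrite /eta in eta0 *; lra.
move=> c c1 cl; have := ulow j j (c - eta - eta) jk jk.
have dx0 := pm_ge0 x0 (x j) dP.
have -> : (c - eta - eta <= 1) = true by lra.
have -> : (c - eta - eta <= d x0 (x j) + 1) = true by lra.
move=> /(_ isT isT) ulow'.
have : c - eta - eta <= d (u x0) (x j).
  apply: ulow' => l lk; rewrite (pm0 dP).
  by have := cl _ lk; have := xd l j; rewrite ler_norml => /andP[? ?]; lra.
by have := xP j; rewrite /eta in eta0 *; lra.
Qed.

End Linkable.

End Completion.

(** * From approximate to exact extension properties *)

Section Exact.
Context {R : realType}.
Local Notation h := (@halfn R).

Let le_h (r c s : R) : 0 < c -> (forall n, r <= c * h n + s) -> r <= s.
Proof.
move=> c0 rc; apply/ler_addgt0Pr => e e0.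
have [n] := halfn_lt (divr_gt0 e0 c0); rewrite ltr_pdivlMr// mulrC => ne.
by have := rc n; lra.
Qed.

Variable M : metricType R.
Hypothesis Mc : complete_metric M.

Let sequence_cvg (x : nat -> M) :
  (forall n, mdist (x n) (x n.+1) <= 2 * h n) ->
  exists l, forall n, mdist (x n) l <= 4 * h n.
Proof.
move=> xh.
have xk n k : mdist (x n) (x (n + k)%N) <= 4 * h n - 4 * h (n + k)%N.
  elim: k => [|k IH]; first by rewrite addn0 mdistxx subrr.
  have := metric_triangle (x n) (x (n + k)%N) (x (n + k.+1)%N).
  by have := xh (n + k)%N; rewrite addnS; have := halfnS R (n + k)%N; lra.
have xn n m : (n <= m)%N -> mdist (x n) (x m) <= 4 * h n.
  by move=> /subnKC <-; have := xk n (m - n)%N; have := halfn_gt0 R (n + (m - n))%N; lra.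
have [|l xl] := Mc (F := x @ \oo).
  apply/cauchyP => e e0; have e4 : 0 < e / 4 by rewrite divr_gt0.
  have [n ne] := halfn_lt e4; exists (x n); exists n => // m /= nm.
  by rewrite ballEmdist /=; have := xn _ _ nm; lra.
exists l => n; apply/ler_addgt0Pr => e e0.
move/metricType_numDomainType.cvgrPdist_lt : xl => /(_ _ e0)[N _ Nx].
have := Nx (maxn n N) (leq_maxr _ _); have := xn n (maxn n N) (leq_maxl _ _).
by have := metric_triangle (x n) (x (maxn n N)) l; rewrite /= (metric_sym l); lra.
Qed.

Hypothesis M1 : forall x y : M, mdist x y <= 1.

(** The identity has error at most [1]. At stage [n] an isometry moving no point by more than [h n]
    reduces the error to [h n.+1], so the composites converge uniformly to an exact solution. *)
Lemma homogeneous_of_approx :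
  (forall k (a b : nat -> M) e r, 0 <= e -> 0 < r ->
    (forall i, (i < k)%N -> mdist (a i) (b i) <= e) ->
    (forall i j, (i < k)%N -> (j < k)%N -> mdist (a i) (a j) = mdist (b i) (b j)) ->
    exists U : Iso M, (forall f, mdist (U f) f <= e) /\
      forall i, (i < k)%N -> mdist (U (a i)) (b i) <= r) ->
  omega_homogeneous M.
Proof.
move=> approx A B f /finite_seqP[s ->] _ _ fiso.
have [->|/set0P[m0 _]] := eqVneq [set` s] set0; first by exists 1%g.
pose a i := nth m0 s i; pose b i := f (a i).
have as_ i : (i < size s)%N -> [set` s] (a i) by exact: mem_nth.
pose P n (g : Iso M) := forall i, (i < size s)%N -> mdist (g (a i)) (b i) <= h n.
have /choice[nxt nxtP] (q : nat * Iso M) : exists g' : Iso M,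
    P q.1 q.2 -> P q.1.+1 g' /\ forall x, mdist (q.2 x) (g' x) <= h q.1.
  have [Pq|nP] := pselect (P q.1 q.2); last by exists 1%g.
  have [|i j ik jk|U [Uh Ua]] := approx (size s) (q.2 \o a) b (h q.1) (h q.1.+1) _ (halfn_gt0 R _) Pq.
  - exact: ltW (halfn_gt0 R _).
  - by rewrite /= Iso_isometric// -fiso//; exact: as_.
  - exists (U * q.2)%g => _; split=> [i ik|x]; first exact: Ua.
    by rewrite metric_sym; exact: Uh.
pose g := fix g n := if n is n'.+1 then nxt (n', g n') else 1%g.
have gP n : P n (g n).
  elim: n => [|n IH]; last by have [] := nxtP (n, g n) IH.
  by move=> i _; rewrite halfn0; exact: M1.
have gS n x : mdist (g n x) (g n.+1 x) <= h n by have [_] := nxtP (n, g n) (gP n); exact.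
have /choice[G GP] x : exists l, forall n, mdist (g n x) l <= 4 * h n.
  by apply: sequence_cvg => n; have := gS n x; have := halfn_gt0 R n; lra.
have Giso : isometric_on [set: M] G.
  move=> x y _ _; have tri n : `|mdist (G x) (G y) - mdist x y| <= 8 * h n.
    have := GP x n; have := GP y n.
    have <- : mdist (g n x) (g n y) = mdist x y by rewrite Iso_isometric.
    have := metric_triangle (G x) (g n x) (G y).
    have := metric_triangle (g n x) (g n y) (G y).
    have := metric_triangle (g n x) (G x) (g n y).
    have := metric_triangle (G x) (G y) (g n y).
    rewrite (metric_sym (G x) (g n x)) (metric_sym (G y) (g n y)) => *.
    by rewrite ler_norml; apply/andP; split; lra.
  apply/eqP; rewrite -subr_eq0 -normr_le0; apply: (@le_h _ 8) => // n.
  by rewrite addr0.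
have Gsurj y : exists x, G x = y.
  (* The inverses converge too: consecutive values at [y] are as far apart as [g n] and [g n.+1] at
     the preimage of [y] under [g n]. *)
  have [|z zP] := @sequence_cvg (fun n => (g n)^-1%g y).
    move=> n; rewrite -(Iso_isometric (g n.+1))// [X in mdist _ X](Iso_inv_funK (g n.+1)).
    have := gS n (Iso_inv_fun (g n) y); rewrite (Iso_inv_funK (g n)) metric_sym.
    by move=> le; apply: le_trans le _; have := halfn_gt0 R n; lra.
  exists z; apply: mdist_positivity; apply/eqP; rewrite eq_le mdist_ge0 andbT.
  apply: (@le_h _ 8) => // n; rewrite addr0.
  have := metric_triangle (G z) (g n z) y; rewrite (metric_sym (G z) (g n z)).
  have gzn : mdist (g n z) y = mdist (Iso_inv_fun (g n) y) z.
    by rewrite -[in LHS](Iso_inv_funK (g n) y) Iso_isometric// metric_sym.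
  by have := zP n; rewrite gzn; have := GP z n; lra.
exists (MkIso Giso Gsurj) => x /= /(nthP m0)[i ik <-].
apply: mdist_positivity; apply/eqP; rewrite eq_le mdist_ge0 andbT.
apply: (@le_h _ 5) => // n; rewrite addr0.
have := gP n i ik; have := GP (a i) n.
have := metric_triangle (G (a i)) (g n (a i)) (b i).
by rewrite (metric_sym (G (a i)) (g n (a i))) /b /a; lra.
Qed.

Hypothesis m0 : M.
Hypothesis approx : forall k (m : nat -> M) (rho : nat -> R) delta,
  0 < delta -> (forall i, (i < k)%N -> 0 <= rho i) ->
  (forall i j, (i < k)%N -> (j < k)%N -> mdist (m i) (m j) <= rho i + rho j) ->
  exists p : M, forall j, (j < k)%N -> mdist p (m j) <= rho j + delta /\
    forall c, c <= 1 -> (forall i, (i < k)%N -> c <= rho i + mdist (m i) (m j)) ->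
      c - delta <= mdist p (m j).

(** The hypotheses make [rho] a Katetov function bounded by [1]; a point realising it is the limit
    of successive corrections with halving errors. *)
Lemma one_point_extension k (m : nat -> M) (rho : nat -> R) :
  (forall i, (i < k)%N -> 0 <= rho i <= 1) ->
  (forall i j, (i < k)%N -> (j < k)%N -> rho i <= rho j + mdist (m j) (m i)) ->
  (forall i j, (i < k)%N -> (j < k)%N -> mdist (m i) (m j) <= rho i + rho j) ->
  exists p : M, forall j, (j < k)%N -> mdist p (m j) = rho j.
Proof.
move=> rho01 rhol rhou.
pose P n p := forall i, (i < k)%N -> `|mdist p (m i) - rho i| <= h n.
have /choice[nxt nxtP] (q : nat * M) : exists p',
    P q.1 q.2 -> P q.1.+1 p' /\ mdist q.2 p' <= 2 * h q.1.
  have [Pq|nP] := pselect (P q.1 q.2); last by exists m0.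
  case: q Pq => n p /= Pq; have hn := halfn_gt0 R n; have hSn := halfn_gt0 R n.+1; have := halfnS R n.
  move=> hE.
  (* The current point joins the list with prescribed distance [h n], so the next one stays within
     [2 * h n] of it. *)
  have [||p' p'P] := @approx k.+1 (fun i => if (i < k)%N then m i else p)
      (fun i => if (i < k)%N then rho i else h n) (h n.+1) hSn.
  - by move=> i _; case: ifPn => ik; [have /andP[] := rho01 _ ik|exact: ltW].
  - move=> i j _ _; case: ifPn => ik; case: ifPn => jk.
    + exact: rhou.
    + by have := Pq _ ik; rewrite ler_norml metric_sym => /andP[_ ?]; lra.
    + by have := Pq _ jk; rewrite ler_norml => /andP[_ ?]; lra.
    + by rewrite mdistxx; lra.
  - exists p' => _; split=> [j jk|]; last first.
      by have [] := p'P k (ltnSn _); rewrite ltnn metric_sym => ? _; lra.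
    have [up low] := p'P j (leqW jk); rewrite jk in up low.
    have : rho j - h n.+1 <= mdist p' (m j).
      apply: low => [|i _]; first by have /andP[] := rho01 _ jk.
      case: ifPn => ik; first exact: rhol.
      by have := Pq _ jk; rewrite ler_norml => /andP[? _]; lra.
    by move=> ?; rewrite ler_norml; apply/andP; split; lra.
pose x := fix x n := if n is n'.+1 then nxt (n', x n') else m0.
have xP n : P n (x n).
  elim: n => [|n IH]; last by have [] := nxtP (n, x n) IH.
  move=> i ik; have /andP[r0 r1] := rho01 _ ik; have := M1 m0 (m i).
  have := mdist_ge0 m0 (m i); rewrite halfn0 => *.
  by rewrite ler_norml; apply/andP; split; lra.
have [|p pP] := @sequence_cvg x.
  by move=> n; have [_] := nxtP (n, x n) (xP n).
exists p => j jk; apply/eqP; rewrite -subr_eq0 -normr_le0.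
apply: (@le_h _ 5) => // n; rewrite addr0.
have := xP n j jk; have := pP n; rewrite !ler_norml.
have := metric_triangle p (x n) (m j); have := metric_triangle (x n) p (m j).
by rewrite (metric_sym p (x n)) => ? ? ? /andP[? ?]; apply/andP; split; lra.
Qed.

Lemma diam_of_approx : diam M = 1%E.
Proof.
apply/eqP; rewrite eq_le; apply/andP; split.
  by apply: ge_ereal_sup => _ [x _ [y _ <-]]; rewrite lee_fin; exact: M1.
have [|||p p1] := @one_point_extension 1 (fun=> m0) (fun=> 1).
- by move=> i _; rewrite ler01 lexx.
- by move=> i j _ _; rewrite lerDl mdist_ge0.
- by move=> i j _ _; rewrite mdistxx addr_ge0.
- apply: ereal_sup_ubound; exists p => //; exists m0 => //.
  by rewrite (p1 0%N).
Qed.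

(** The points of [L] are added one at a time; the distances from a new point to the earlier ones
    form a Katetov function on their images. *)
Lemma Urysohn_of_approx : Urysohn_metric M.
Proof.
split; first exact: diam_of_approx.
move=> L K f finL diamL fK.
have L1 (x y : L) : mdist x y <= 1.
  rewrite -lee_fin; apply: le_trans diamL; apply: ereal_sup_ubound.
  by exists x => //; exists y.
suff ext (s : seq L) : exists g : L -> M,
    isometric_on (K `|` [set` s]) g /\ forall x, K x -> g x = f x.
  have [s sL] := (finite_seqP _).1 finL; have [g [giso gf]] := ext s.
  have sT z : (K `|` [set` s]) z by right; rewrite -sL.
  by exists g; split=> // x y _ _; exact: giso.
elim: s => [|x s [g [giso gf]]].
  by exists f; split=> // x y [Kx|//] [Ky|//]; exact: fK.
have [Bx|nBx] := pselect ((K `|` [set` s]) x).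
  have xs y : (K `|` [set` x :: s]) y -> (K `|` [set` s]) y.
    by move=> [|/=]; [left|rewrite inE => /orP[/eqP->//|]; right].
  by exists g; split=> // y z /xs By /xs Bz; exact: giso.
have [t tB] : exists t : seq L, K `|` [set` s] = [set` t].
  by apply/finite_seqP; apply: sub_finite_set finL.
have tP i : (i < size t)%N -> (K `|` [set` s]) (nth x t i).
  by move=> it; rewrite tB; exact: mem_nth.
have [|i j it jt|i j it jt|p pP] := @one_point_extension (size t)
    (fun i => g (nth x t i)) (fun i => mdist x (nth x t i)).
- by move=> i it; rewrite mdist_ge0 L1.
- by rewrite giso ?metric_triangle//; exact: tP.
- rewrite giso; [|exact: tP|exact: tP].
  by rewrite (metric_sym x (nth x t i)) metric_triangle.
have gp y : (K `|` [set` s]) y -> mdist p (g y) = mdist x y.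
  by rewrite tB => /= /(nthP x)[i it <-]; exact: pP.
exists (fun y => if y == x then p else g y); split=> [y z|y Ky]; last first.
  by case: eqVneq => [yx|_]; [case: nBx; left; rewrite -yx|exact: gf].
have xs w : (K `|` [set` x :: s]) w -> w = x \/ (w != x /\ (K `|` [set` s]) w).
  move=> Bw; case: (eqVneq w x) => [|wx]; [by left|right; split=> //].
  by case: Bw => [|/=]; [left|rewrite inE (negbTE wx); right].
move=> /xs[->|[/negbTE-> By]] /xs[->|[/negbTE-> Bz]]; rewrite ?eqxx.
- by rewrite !mdistxx.
- exact: gp.
- by rewrite metric_sym gp// metric_sym.
- exact: giso.
Qed.

(** A point at distance [1] from every member of a finite list is not in the list. *)
Lemma infinite_of_approx : infinite_set [set: M].
Proof.
move=> /finite_seqP[s sM].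
have [|||p p1] := @one_point_extension (size s) (nth m0 s) (fun=> 1).
- by move=> i _; rewrite ler01 lexx.
- by move=> i j _ _; rewrite lerDl mdist_ge0.
- by move=> i j _ _; have := M1 (nth m0 s i) (nth m0 s j); lra.
have : [set: M] p by [].
rewrite sM => /= /(nthP m0)[i ik pi]; have := p1 i ik.
by rewrite pi mdistxx => /eqP; rewrite eq_sym oner_eq0.
Qed.

End Exact.

(** * Left-invariant pseudometrics *)

Section TopologicalGroupTheory.
Context {G : topologicalGroupType}.

Lemma mulgl_continuous (a : G) : continuous (fun x : G => (a * x)%g).
Proof.
move=> x; apply: (@continuous_comp _ _ _ (fun x : G => (a, x)) (fun p : G * G => (p.1 * p.2)%g)).
  by apply: cvg_pair; [exact: cvg_cst|exact: cvg_id].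
exact: mulg_continuous.
Qed.

Lemma mulgr_continuous (a : G) : continuous (fun x : G => (x * a)%g).
Proof.
move=> x; apply: (@continuous_comp _ _ _ (fun x : G => (x, a)) (fun p : G * G => (p.1 * p.2)%g)).
  by apply: cvg_pair; [exact: cvg_id|exact: cvg_cst].
exact: mulg_continuous.
Qed.

Lemma nbhs1_translate (A : set G) (x : G) :
  nbhs (1%g : G) A -> nbhs x [set y | A (y^-1 * x)%g].
Proof.
move=> A1; have F : {for x, continuous (fun y : G => (y^-1 * x)%g)}.
  apply: (@continuous_comp _ _ _ (fun y : G => y^-1%g) (fun y : G => (y * x)%g)).
    exact: invg_continuous.
  exact: mulgr_continuous.
by apply: F; rewrite mulVg.
Qed.

(** The displacement of [x] under left translation by [g] is the conjugate of the inverse of [g] by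
    [x]. *)
Lemma nbhs1_conj (A : set G) (x : G) :
  nbhs (1%g : G) A -> nbhs (1%g : G) [set g | A ((g * x)^-1 * x)%g].
Proof.
move=> /(nbhs1_translate x) Ax.
by have := @mulgr_continuous x 1%g _; rewrite mul1g => /(_ _ Ax).
Qed.

Lemma nbhs1_cube (U : set G) : nbhs (1%g : G) U -> exists V : set G,
  [/\ nbhs (1%g : G) V, (forall x, V x -> V (x^-1)%g) &
      forall x y z, V x -> V y -> V z -> U (x * y * z)%g].
Proof.
have sq (W : set G) : nbhs (1%g : G) W -> exists V : set G,
    nbhs (1%g : G) V /\ forall x y, V x -> V y -> W (x * y)%g.
  move=> W1; have [[V1 V2] /= [V11 V21] VW] : nbhs ((1%g, 1%g) : G * G) [set p | W (p.1 * p.2)%g].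
    by apply: mulg_continuous; rewrite /= mul1g.
  by exists (V1 `&` V2); split=> [|x y [? _] [_ ?]]; [exact: filterI|exact: (VW (x, y))].
move=> U1; have [W [W1 WU]] := sq _ U1; have [V [V1 VW]] := sq _ W1.
have V1' : nbhs (1%g : G) [set x | V (x^-1)%g].
  by have := @invg_continuous G 1%g V; rewrite invg1; exact.
exists (W `&` V `&` [set x | W (x^-1)%g] `&` [set x | V (x^-1)%g]); split.
- apply: filterI => //; apply: filterI; first exact: filterI.
  by have := @invg_continuous G 1%g W; rewrite invg1; exact.
- by move=> x [[[? ?] ?] ?]; rewrite /= invgK.
- by move=> x y z [[[_ Vx] _] _] [[[_ Vy] _] _] [[[Wz _] _] _]; apply: WU => //; exact: VW.
Qed.

(** * The Birkhoff-Kakutani construction *)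

Section BirkhoffKakutani.
Context {R : realType}.
Local Notation h := (@halfn R).

Let h_anti m n : (m <= n)%N -> h n <= h m.
Proof.
move=> /subnK <-; elim: (n - m)%N => [//|k IH].
by rewrite addSn; have := halfnS R (k + m); have := halfn_gt0 R (k + m).+1; lra.
Qed.

Variable V : nat -> set G.
Hypothesis V1 : forall n, nbhs (1%g : G) (V n).
Hypothesis Vinv : forall n x, V n x -> V n (x^-1)%g.
Hypothesis V3 : forall n x y z, V n.+1 x -> V n.+1 y -> V n.+1 z -> V n (x * y * z)%g.

Let V_1 n : V n 1%g.
Proof. exact: nbhs_singleton. Qed.

Let V_anti m n : (m <= n)%N -> V n `<=` V m.
Proof.
move=> /subnK <-; elim: (n - m)%N => [//|k IH] x.
by rewrite addSn => Vx; apply: IH; rewrite -(mulg1 x) -(mulg1 (x * 1)%g); exact: V3.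
Qed.

(** A word is a sequence of letters [(n, x)] with [x] in [V n], each costing [h n]; the length [N]
    of an element is the infimum of the costs of its words, truncated at [1]. *)
Let wt (s : seq (nat * G)) : R := \sum_(p <- s) h p.1.
Let prd (s : seq (nat * G)) : G := foldr (fun p x => (p.2 * x)%g) 1%g s.
Let valid (s : seq (nat * G)) := forall p, p \in s -> V p.1 p.2.

Let wt_ge0 s : 0 <= wt s.
Proof. by apply: sumr_ge0 => p _; exact: ltW (halfn_gt0 R _). Qed.

Let prd_cat s t : prd (s ++ t) = (prd s * prd t)%g.
Proof. by elim: s => [|p s IH] /=; rewrite ?mul1g// IH mulgA. Qed.

(** The cut is at the first letter whose remaining tail weighs less than [c]. Until then the tail
    takes at least [c] of the total, so the weight read so far, counted from [a], stays below
    [c]. *)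
Let wt_split s a c : 0 < c -> a < c -> s <> [::] -> a + wt s < c + c ->
  exists s1 p s2, [/\ s = s1 ++ p :: s2, a + wt s1 < c & wt s2 < c].
Proof.
move=> c0; elim: s a => [//|p t IH] a ac _; rewrite /wt big_cons -/(wt t) => lt.
have [tc|tc] := ltP (wt t) c.
  by exists [::], p, t; rewrite /wt big_nil addr0.
have [||s1 [q [s2 [-> lt1 lt2]]]] := IH (a + h p.1) _ _ (ltac:(lra)); first by lra.
  by move=> t0; move: tc; rewrite t0 /wt big_nil; lra.
by exists (p :: s1), q, s2; rewrite /wt big_cons addrA.
Qed.

(* A product of elements of weights [2^-n_i] is cut at the element where the
   partial sum of the weights crosses one half of the bound. *)
Let key m s n : (size s <= m)%N -> valid s -> wt s < h n -> V n (prd s).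
Proof.
elim: m s n => [|m IH] s n; first by rewrite leqn0 size_eq0 => /eqP-> _ _; exact: V_1.
have [->|/eqP s0] := eqVneq s [::]; first by move=> _ _ _; exact: V_1.
move=> sm sv; rewrite halfnS => lt.
have [|s1 [p [s2 [sE lt1 lt2]]]] := @wt_split s 0 (h n.+1) (halfn_gt0 R _) (halfn_gt0 R _) s0.
  by rewrite add0r.
rewrite sE prd_cat /= mulgA; apply: V3.
- apply: IH; last by move: lt1; rewrite add0r.
    by move: sm; rewrite sE size_cat /= addnS ltnS; apply: leq_trans; exact: leq_addr.
  by move=> q qs; apply: sv; rewrite sE mem_cat qs.
(* The middle letter weighs less than [h n], so its index exceeds [n]. *)
- apply: (@V_anti _ p.1); last by apply: sv; rewrite sE mem_cat inE eqxx orbT.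
  rewrite ltnNge; apply/negP => /h_anti; have := halfnS R n.
  move: lt; rewrite sE /wt big_cat big_cons /= -/(wt s1) -/(wt s2).
  by have := wt_ge0 s1; have := wt_ge0 s2; lra.
- apply: IH => //.
    by move: sm; rewrite sE size_cat /= addnS ltnS; apply: leq_trans; exact: leq_addl.
  by move=> q qs; apply: sv; rewrite sE mem_cat inE qs !orbT.
Qed.

Let N (z : G) : R := inf1 (fun r => exists s, [/\ valid s, prd s = z & r = wt s]).

Let N_le s : valid s -> N (prd s) <= wt s.
Proof. by move=> sv; apply: inf1_le => //; exists s. Qed.

Let N1 : N 1%g = 0.
Proof.
apply/eqP; rewrite eq_le inf1_ge0 andbT; have := @N_le [::].
by rewrite /wt big_nil; apply.
Qed.

Let NM x y : N (x * y)%g <= N x + N y.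
Proof.
apply: le_inf1D; first exact: inf1_le1.
move=> _ _ _ _ [s [sv <- ->]] [t [tv <- ->]]; rewrite -prd_cat /wt -big_cat.
by apply: N_le => p; rewrite mem_cat => /orP[/sv|/tv].
Qed.

Let NV x : N (x^-1)%g <= N x.
Proof.
apply: le_inf1; first exact: inf1_le1.
move=> _ _ [s [sv <- ->]]; pose t := rev [seq (p.1, (p.2^-1)%g) | p <- s].
have -> : wt s = wt t.
  by rewrite /wt /t (perm_big _ (permEl (perm_rev _))) /= big_map.
have -> : ((prd s)^-1 = prd t)%g.
  rewrite /t; elim: s {sv t} => [|p s IH] /=; first by rewrite invg1.
  by rewrite rev_cons -cats1 prd_cat invgM IH /= mulg1.
by apply: N_le => p; rewrite mem_rev => /mapP[q qs ->]; apply: Vinv; exact: (sv q qs).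
Qed.

Lemma left_invariant_pmetric : exists rho : G -> G -> R,
  [/\ pmetric rho, (forall g x y, rho (g * x)%g (g * y)%g = rho x y),
      (forall e, 0 < e -> nbhs (1%g : G) [set g | rho 1%g g <= e]) &
      forall g, rho 1%g g < 1 -> V 0 g].
Proof.
exists (fun x y => N (x^-1 * y)%g); split.
- split=> [x|x y|x y z|x y].
  + by rewrite mulVg.
  + suff le x' y' : N (x'^-1 * y')%g <= N (y'^-1 * x')%g.
      by apply/eqP; rewrite eq_le !le.
    by apply: le_trans (NV _); rewrite invgM invgK.
  + by apply: le_trans (NM _ _); rewrite mulgA -(mulgA x^-1%g) mulgV mulg1.
  + exact: inf1_le1.
- by move=> g x y; rewrite invgM mulgA -(mulgA x^-1%g) mulVg mulg1.
- move=> e e0; have [n ne] := halfn_lt e0; apply: filterS (V1 n) => g Vg /=.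
  rewrite invg1 mul1g; apply: le_trans (ltW ne).
  have := @N_le [:: (n, g)]; rewrite /= mulg1 /wt big_seq1; apply.
  by move=> p; rewrite inE => /eqP->.
- move=> g; rewrite invg1 mul1g => Ng; apply: contrapT => nVg.
  suff : 1 <= N g by lra.
  apply: le_inf1 => // _ _ [s [sv sg ->]]; rewrite leNgt; apply/negP => lt.
  by apply: nVg; rewrite -sg; apply: (@key (size s)).
Qed.

End BirkhoffKakutani.

Lemma birkhoff_kakutani (R : realType) (U : set G) : nbhs (1%g : G) U ->
  exists rho : G -> G -> R,
  [/\ pmetric rho, (forall g x y, rho (g * x)%g (g * y)%g = rho x y),
      (forall e, 0 < e -> nbhs (1%g : G) [set g | rho 1%g g <= e]) &
      forall g, rho 1%g g < 1 -> U g].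
Proof.
move=> U1.
have /choice[nxt nxtP] (W : set G) : exists V : set G, nbhs (1%g : G) W ->
  [/\ nbhs (1%g : G) V, (forall x, V x -> V (x^-1)%g) &
      forall x y z, V x -> V y -> V z -> W (x * y * z)%g].
  have [W1|nW1] := pselect (nbhs (1%g : G) W); last by exists W.
  by have [V VP] := nbhs1_cube W1; exists V.
(* Starting one step after [U] makes every [V n] symmetric, [V 0] included, and keeps [V 0] inside
   [U]. *)
pose V n := iter n.+1 nxt U.
have V1 n : nbhs (1%g : G) (V n).
  by elim: n => [|n IH]; [have [] := nxtP _ U1|have [] := nxtP _ IH].
have Vinv n x : V n x -> V n (x^-1)%g.
  by case: n => [|n]; [have [_ + _] := nxtP _ U1|have [_ + _] := nxtP _ (V1 n)]; apply.
have V3 n x y z : V n.+1 x -> V n.+1 y -> V n.+1 z -> V n (x * y * z)%g.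
  by have [_ _] := nxtP _ (V1 n); apply.
have [rho [rho_pm rho_inv rho_cont rhoV]] := @left_invariant_pmetric R V V1 Vinv V3.
exists rho; split=> // g /rhoV V0g; have [_ _] := nxtP _ U1.
have V01 : V 0%N 1%g by exact: nbhs_singleton.
by move=> /(_ g 1%g 1%g V0g V01 V01); rewrite !mulg1.
Qed.

End TopologicalGroupTheory.

(** * The embedding *)

Section Construction.
Context {R : realType} {G : topologicalGroupType} (J : Type).
Hypothesis infJ : infinite_set [set: J].
Variable base : J -> set G.
Hypothesis baseP : basis (range base).

Lemma basis_nbhs (T : topologicalType) (B : set (set T)) (x : T) (A : set T) :
  basis B -> nbhs x A -> exists U, [/\ B U, U x & U `<=` A].
Proof. by move=> [_ /(_ x)] Bx /Bx[U [BU Ux] UA]; exists U. Qed.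

Let rho_ex (j : J) : exists rho : G -> G -> R,
  [/\ pmetric rho, (forall g x y, rho (g * x)%g (g * y)%g = rho x y),
      (forall e, 0 < e -> nbhs (1%g : G) [set g | rho 1%g g <= e]) &
      nbhs (1%g : G) (base j) -> forall g, rho 1%g g < 1 -> base j g].
Proof.
have [j1|nj1] := pselect (nbhs (1%g : G) (base j)).
  by have [rho [? ? ? rhoU]] := birkhoff_kakutani R j1; exists rho; split.
(* Default when [base j] is not a neighbourhood of [1]: any continuous left-invariant pseudometric
   serves. *)
by have [rho [? ? ? _]] := @birkhoff_kakutani G R setT filterT; exists rho; split.
Qed.

Let rho j := sval (cid (rho_ex j)).

Let rho_pm j : pmetric (rho j).
Proof. by rewrite /rho; case: cid => ? []. Qed.

Let rho_inv j g x y : rho j (g * x)%g (g * y)%g = rho j x y.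
Proof. by rewrite /rho; case: cid => ? []. Qed.

Let rho_cont j e : 0 < e -> nbhs (1%g : G) [set g | rho j 1%g g <= e].
Proof. by rewrite /rho; case: cid => ? [_ _ + _] /=; apply. Qed.

Let rho_base j : nbhs (1%g : G) (base j) -> forall g, rho j 1%g g < 1 -> base j g.
Proof. by rewrite /rho; case: cid => ? [_ _ _] /=; apply. Qed.

(** Different copies of [G] are at the maximal distance [1], which secures the triangle inequality
    across copies. *)
Definition dist0 (p q : G * J) : R :=
  if pselect (p.2 = q.2) then rho p.2 p.1 q.1 else 1.

Definition act0 g (p : G * J) : G * J := ((g * p.1)%g, p.2).

Let dist0_same g h j : dist0 (g, j) (h, j) = rho j g h.
Proof. by rewrite /dist0; case: pselect. Qed.

Let dist0_pm : pmetric dist0.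
Proof.
split=> [[x i]|[x i] [y j]|[x i] [y j] [z k]|[x i] [y j]].
- by rewrite dist0_same; exact: pm0.
- rewrite /dist0 /=; case: pselect => ij; case: pselect => // ji.
  + by subst i; exact: pmC.
  + by case: ji.
  + by case: ij.
- rewrite /dist0 /=; case: pselect => ik; case: pselect => ij; case: pselect => jk //.
  + by subst i j; exact: pmD.
  + by case: jk; rewrite -ij.
  + by case: ij; rewrite ik.
  + by have := pm_le1 (rho_pm i) x z; rewrite /=; lra.
  + by case: ik; rewrite ij.
  + by rewrite lerDr /= pm_ge0.
  + by rewrite lerDl /= pm_ge0.
  + by rewrite /=; lra.
- by rewrite /dist0; case: pselect => //= ij; exact: pm_le1.
Qed.

Let dist0_act g p q : dist0 (act0 g p) (act0 g q) = dist0 p q.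
Proof. by rewrite /dist0 /=; case: pselect => //= ij; exact: rho_inv. Qed.

Let act0_1 p : act0 1%g p = p.
Proof. by case: p => x j; rewrite /act0 /= mul1g. Qed.

Let act0_M g h p : act0 (g * h)%g p = act0 g (act0 h p).
Proof. by rewrite /act0 /= mulgA. Qed.

Let rho_translate j x y : rho j x y = rho j 1%g (x^-1 * y)%g.
Proof. by rewrite -(rho_inv j x^-1%g) mulVg. Qed.

Let dist0_cont p e : 0 < e -> nbhs (1%g : G) [set g | dist0 (act0 g p) p <= e].
Proof.
case: p => x j /(rho_cont j)/(nbhs1_conj x); apply: filterS => g /=.
by rewrite dist0_same (rho_translate j (g * x)%g).
Qed.

(** One point of each nonempty basic set, repeated in all copies: every ball contains a basic set
    around its centre, hence a chosen point. *)
Let dist0_dense : exists u : J -> G * J,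
  forall p e, 0 < e -> exists j, dist0 (u j) p <= e.
Proof.
have /choice[f fP] j : exists g, base j !=set0 -> base j g.
  by have [[g jg]|] := pselect (base j !=set0); [exists g|exists 1%g].
have [s sP] := surjects_square infJ.
exists (fun j => (f (s j).1, (s j).2)) => -[x j] e /(rho_cont j)/(nbhs1_translate x) xe.
have [_ [[i _ <-] ix iA]] := basis_nbhs baseP xe.
have [k sk] := sP (i, j); exists k; rewrite sk dist0_same rho_translate.
by apply: iA; apply: fP; exists x.
Qed.

(** The initial stage has only the finitely linked functions. It is transparent because
    [F_embedding] computes its distance. *)
Let s0 : @stage R G J.
Proof.
apply: (mkstage (E := fun=> False) infJ dist0_pm act0_1 act0_M dist0_act
  dist0_cont dist0_dense) => //.
by exists (fun=> dist0).
Defined.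

Notation X := (lim_pt infJ s0).
Notation d := (@ldist _ _ _ infJ s0).
Let dP : pmetric d := ldist_pm infJ s0.
Let M : metricType R := completion dP.

Let actVK g (x : X) : d (lact g^-1%g (lact g x)) x = 0.
Proof. by rewrite -lactM mulVg lact1 (pm0 dP). Qed.

Let actKV g (x : X) : d (lact g (lact g^-1%g x)) x = 0.
Proof. by rewrite -lactM mulgV lact1 (pm0 dP). Qed.

Let F (g : G) : Iso M := lift dP (lactd g) (lactd g^-1%g) (actVK g) (actKV g).

Let F_morph : {morph F : g h / (g * h)%g}.
Proof.
move=> g h; apply: IsoP => m; apply: cfun_inj => y.
by rewrite [LHS]liftE [RHS]liftE liftE invgM lactM.
Qed.

Let F1 : F 1%g = 1%g.
Proof. by apply: (mulgI (F 1%g)); rewrite -F_morph !mulg1. Qed.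

Let F_dist g h m : mdist (F g m) (F h m) = mdist m (F (g^-1 * h)%g m).
Proof.
rewrite -(Iso_isometric (F g^-1%g))//.
rewrite -[F g^-1%g (F g m)]/((F g^-1 * F g)%g m) -[F g^-1%g (F h m)]/((F g^-1 * F h)%g m).
by rewrite -!F_morph mulVg F1.
Qed.

Let F_near1 m e : 0 < e -> nbhs (1%g : G) [set g | mdist m (F g m) < e].
Proof.
move=> e0; have e4 : 0 < e / 4 by rewrite divr_gt0.
have [x xm] := cinc_dense m e4.
apply: filterS (lcont x e4) => g /= gx.
have := metric_triangle m (cinc dP x) (F g m).
have := metric_triangle (cinc dP x) (F g (cinc dP x)) (F g m).
have -> : mdist (cinc dP x) (F g (cinc dP x)) = d (lact g x) x.
  by rewrite /F lift_cinc mdist_cinc2 (pmC dP).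
rewrite Iso_isometric// (metric_sym m (cinc dP x)).
by lra.
Qed.

Let F_continuous : continuous F.
Proof.
apply: continuous_to_Iso => m g; apply/metricType_numDomainType.cvgrPdist_lt => e e0.
have := @mulgl_continuous G g^-1%g g; rewrite /continuous_at mulVg => /(_ _ (F_near1 m e0)) near_g.
apply: (@filterS G (nbhs g) _ _ _ _ near_g) => h /=.
by rewrite F_dist.
Qed.

(** For [base j] inside [U], the point [(1, j)] is moved by [g] over the distance [rho j 1 g], and
    [rho j] was chosen so that its unit ball lies in [base j]. *)
Let F_embedding (U : set G) : nbhs (1%g : G) U ->
  exists m : M, exists2 e, 0 < e & forall g, mdist m (F g m) < e -> U g.
Proof.
move=> U1; have [_ [[j _ <-] j1 jU]] := basis_nbhs baseP U1.
have [p [p0 pE]] := @lim_pt_ex _ _ _ infJ s0 0 (1%g, j).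
exists (cinc dP p); exists 1 => // g; rewrite /F lift_cinc mdist_cinc2.
rewrite (ldistE (N := 0%N))//= pE => lt; apply: jU; apply: rho_base.
  by apply: open_nbhs_nbhs; split=> //; apply: baseP.1; exists j.
by move: lt; rewrite /act0 dist0_same mulg1.
Qed.

Let linkM : linkable d.
Proof. by move=> k a b r e; exact: lim_isometry. Qed.

Lemma construction : exists M : metricType R,
  [/\ complete_metric M, omega_homogeneous M, Urysohn_metric M,
      infinite_set [set: M] /\
      (exists u : J -> M, forall m e, 0 < e -> exists j, mdist (u j) m <= e) &
      exists F : G -> Iso M,
      [/\ {morph F : g h / (g * h)%g}, continuous F &
          forall U : set G, nbhs (1%g : G) U ->
          exists m : M, exists2 e, 0 < e & forall g, mdist m (F g m) < e -> U g]].
Proof.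
have Mc : complete_metric M by exact: completion_complete.
have M1 (x y : M) : mdist x y <= 1 by exact: mdist_completion_le1.
have [j0] := index_inhabited infJ.
have [p0 _] := @lim_pt_ex _ _ _ infJ s0 0 (1%g, j0); pose m0 : M := cinc dP p0.
have ext := approx_extension linkM m0.
exists M; split=> //.
- by apply: homogeneous_of_approx => //; exact: approx_homogeneous linkM.
- exact: Urysohn_of_approx M1 m0 ext.
- split; first exact: infinite_of_approx M1 m0 ext.
  have [u uP] := ldense infJ s0; exists (cinc dP \o u) => m e e0.
  have e2 : 0 < e / 2 by rewrite divr_gt0.
  have [x xm] := cinc_dense m e2; have [j ju] := uP x _ e2.
  exists j; have := metric_triangle (cinc dP (u j)) (cinc dP x) m.
  by rewrite mdist_cinc2 /=; lra.
- by exists F.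
Qed.

End Construction.

(** * Bases and weights *)

Section Weight.

Lemma card_eqW T U (A : set T) (B : set U) : A #= B -> A #<= B.
Proof. by rewrite card_eq_le => /andP[]. Qed.

(** With a finite base, a point of a Hausdorff space is determined by the Boolean vector recording
    which basic sets contain it. *)
Lemma infinite_basis (T : topologicalType) (B : set (set T)) :
  hausdorff_space T -> basis B -> infinite_set [set: T] -> infinite_set B.
Proof.
move=> hT BB infT /finite_seqP[s sB]; apply: infT.
pose code (x : T) := map_tuple (fun U : set T => `[< U x >]) (in_tuple s).
have codeP x y : code x = code y -> x = y.
  move=> xy; apply: hT => A C xA yC.
  have [U [BU Ux UA]] := basis_nbhs BB xA.
  exists y; split; last exact: nbhs_singleton.
  apply: UA; apply/asboolP.
  have : [seq `[< U' x >] | U' <- s] = [seq `[< U' y >] | U' <- s].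
    by have := congr1 val xy.
  move/eq_in_map/(_ U) => <-; first exact/asboolP.
  by move: BU; rewrite sB.
apply: (@card_le_finite _ _ _ [set: (size s).-tuple bool]).
  by apply: (@card_le_fun _ _ _ _ code) => // x y _ _; exact: codeP.
exact: finite_finset.
Qed.

Lemma dense_basis (R : realType) (J : Type) (M : metricType R) (u : J -> M) :
  infinite_set [set: J] ->
  (forall m (e : R), 0 < e -> exists j, mdist (u j) m <= e) ->
  exists B : set (set M), basis B /\ B #<= [set: J].
Proof.
move=> infJ uP.
have [p pP] : surjects J (J * nat).
  by apply: surjects_prod (surjects_nat _) => //; exists id => y; exists y.
pose b j : set M := (ball (u (p j).1) (p j).2.+1%:R^-1)°.
exists (range b); split; last exact: card_image_le.
split=> [_ [j _ <-]|x A]; first exact: open_interior.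
rewrite -metricType_numDomainType.nbhs_nbhs_mdist => -[e /= e0 eA].
have e4 : 0 < e / 4 by rewrite divr_gt0.
have [n] := ltr_add_invr e4; rewrite add0r => ne.
(* The centre [u j] is within half the radius of [x], so the ball is a neighbourhood of [x]; the
   radius being below [e / 4], the ball stays in [A]. *)
have n2 : 0 < n.+1%:R^-1 / 2 :> R by rewrite divr_gt0// invr_gt0.
have [j jx] := uP x _ n2; have [i pi] := pP (j, n).
exists (b i) => [|y /interior_subset].
  split; first by exists i.
  rewrite /b pi /interior /= -metricType_numDomainType.nbhs_nbhs_mdist.
  exists (n.+1%:R^-1 / 2) => // y /= xy; rewrite ballEmdist /=.
  apply: le_lt_trans (metric_triangle _ x _) _.
  by rewrite [ltRHS]splitr ler_ltD.
rewrite pi ballEmdist /= => yj; apply: eA => /=.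
have := metric_triangle x (u j) y; rewrite (metric_sym x (u j)).
by move: ne jx yj; move: (n.+1%:R^-1 : R) => t; lra.
Qed.

(* One point [m] controls a neighbourhood of [1], so the sets
   [[set g | F g p \in W]], with [p] taken from a basic open set [V], form a
   basis already, without finite intersections. *)
Lemma basis_of_embedding (R : realType) (G : topologicalGroupType) (M : metricType R)
    (F : G -> Iso M) (B : set (set M)) :
  {morph F : g h / (g * h)%g} -> continuous F ->
  (forall U : set G, nbhs (1%g : G) U ->
    exists m : M, exists2 e : R, 0 < e & forall g, mdist m (F g m) < e -> U g) ->
  infinite_set B -> basis B -> exists C : set (set G), basis C /\ C #<= B.
Proof.
move=> F_morph F_cont F_emb infB BB.
have infJ : infinite_set [set: B].
  by move=> fB; apply: infB; apply: card_le_finite fB; exact: card_eqW (card_setT_sym B).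
have /choice[p pP] (U : set M) : exists m, U !=set0 -> U m.
  have [m _] := F_emb setT filterT.
  by have [[x Ux]|] := pselect (U !=set0); [exists x|exists m].
have [s sP] := surjects_square infJ.
pose c (j : B) : set G := [set g | val (s j).2 (F g (p (val (s j).1)))].
exists (range c); split; last first.
  exact: card_le_trans (card_image_le _ _) (card_eqW (card_setT B)).
have F_cont_at m : continuous (fun g => F g m).
  move=> g; apply: (@continuous_comp _ _ _ F (fun f : Iso M => f m)).
    exact: F_cont.
  exact: Iso_eval_continuous.
split=> [_ [j _ <-]|g A gA].
  have openV : open (val (s j).2) by apply: BB.1; exact: set_valP.
  by apply: (@open_comp _ _ (fun g => F g (p (val (s j).1))) _ _ openV) => h _; exact: F_cont_at.
have F1 : F 1%g = 1%g by apply: (mulgI (F 1%g)); rewrite -F_morph !mulg1.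
have A1 : nbhs (1%g : G) [set x | A (g * x)%g].
  by have := @mulgl_continuous G g 1%g; rewrite /continuous_at mulg1 => /(_ _ gA).
have [m [e e0 meA]] := F_emb _ A1.
have e4 : 0 < e / 4 by rewrite divr_gt0.
(* The chosen point [p V] replaces [m] at a cost of [e / 4] before and after, and membership in [W]
   costs another [e / 4]. *)
have [V [BV Vm Ve]] := basis_nbhs BB (nbhsx_ballx m _ e4).
have [W [BW Wm We]] := basis_nbhs BB (nbhsx_ballx (F g (p V)) _ e4).
have Vp : V (p V) by apply: pP; exists m.
have mp : mdist m (p V) < e / 4 by have := Ve _ Vp; rewrite ballEmdist.
have [j sj] := sP (SigSub (mem_set BV), SigSub (mem_set BW)).
exists (c j) => [|x]; first by split; [exists j|rewrite /c sj].
rewrite /c sj /= => /We; rewrite ballEmdist /= => gx.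
have -> : x = (g * (g^-1 * x))%g by rewrite mulgA mulgV mul1g.
apply: meA; have -> : mdist m (F (g^-1 * x)%g m) = mdist (F g m) (F x m).
  rewrite -(Iso_isometric (F g))// -[F g (F _ m)]/((F g * F (g^-1 * x)%g)%g m).
  by rewrite -F_morph mulgA mulgV mul1g.
have := metric_triangle (F g m) (F g (p V)) (F x m).
have := metric_triangle (F g (p V)) (F x (p V)) (F x m).
rewrite (Iso_isometric (F g))// (Iso_isometric (F x))// (metric_sym (p V)).
lra.
Qed.

Lemma has_weight_of_le (T : topologicalType) U (K : set U) (B : set (set T)) :
  basis B -> B #<= K -> (forall C : set (set T), basis C -> K #<= C) ->
  has_weight T K.
Proof.
move=> BB BK Kmin; split=> //; exists B; split=> //.
by rewrite card_eq_le BK Kmin.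
Qed.

Lemma min_basis (T : topologicalType) : exists2 K : set (set T), basis K &
  forall B : set (set T), basis B -> K #<= B.
Proof.
apply: card_le_min; exists (@open T); split=> // x A.
by rewrite nbhsE => -[U [oU Ux] UA]; exists U.
Qed.

End Weight.

(** The Hausdorff axiom makes [F] injective. The inverse is continuous because, after a left
    translation, the displacement of a single point controls each neighbourhood of [1]. *)
Lemma embedding_topgroup_isomorphic (R : realType) (G : topologicalGroupType)
    (hG : hausdorff_space G) (M : metricType R) (F : G -> Iso M) :
  {morph F : g h / (g * h)%g} -> continuous F ->
  (forall U : set G, nbhs (1%g : G) U ->
    exists m : M, exists2 e : R, 0 < e & forall g, mdist m (F g m) < e -> U g) ->
  exists S : groupClosed (Iso M), topgroup_isomorphic G (subgroup S).
Proof.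
move=> F_morph F_cont F_emb.
have F1 : F 1%g = 1%g by apply: (mulgI (F 1%g)); rewrite -F_morph !mulg1.
have FV g : (F g)^-1%g = F g^-1%g.
  by apply: (mulgI (F g)); rewrite mulgV -F_morph mulgV F1.
pose S0 : {pred Iso M} := fun f => `[< exists g, F g = f >].
have S0M : mulg_closed S0.
  move=> _ _ /asboolP[g <-] /asboolP[h <-]; apply/asboolP.
  by exists (g * h)%g.
have S01 : 1%g \in S0 by apply/asboolP; exists 1%g.
have S0V : invg_closed S0.
  by move=> _ /asboolP[g <-]; apply/asboolP; exists g^-1%g; rewrite FV.
pose S : groupClosed (Iso M) := HB.pack S0 (isMulClosed.Build _ S0 S0M)
  (isMul1Closed.Build _ S0 S01) (isInvClosed.Build _ S0 S0V).
have F_dist g h m : mdist (F g m) (F h m) = mdist m (F (g^-1 * h)%g m).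
  rewrite -[in RHS](Iso_isometric (F g))// -[F g (F _ m)]/((F g * F (g^-1 * h)%g)%g m).
  by rewrite -F_morph mulgA mulgV mul1g.
have F_inj : injective F.
  move=> g h Fgh; suff gh1 : (g^-1 * h = 1)%g.
    by rewrite -[RHS]mul1g -(mulgV g) -mulgA gh1 mulg1.
  apply/esym; apply: hG => A C A1 Ch; exists (g^-1 * h)%g.
  split; last exact: nbhs_singleton.
  have [m [e e0]] := F_emb _ A1; apply.
  by rewrite -F_dist Fgh mdistxx.
have FS g : F g \in S by apply/asboolP; exists g.
pose f g : subgroup S := exist _ (F g) (FS g).
have /choice[k kP] (s : subgroup S) : exists g, F g = val s.
  case: s => s sS; have : S0 s by exact: sS.
  by move=> /asboolP.
exists S, f, k; split.
- by move=> g; apply: F_inj; rewrite kP.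
- by move=> s; apply: val_inj; rewrite /= kP.
- by move=> g h; apply: val_inj; rewrite /= F_morph.
- exact: (@continuous_comp_initial _ _ _ (val : subgroup S -> Iso M)).
- move=> s A ksA.
  have A1 : nbhs (1%g : G) [set x | A (k s * x)%g].
    by have := @mulgl_continuous G (k s) 1%g; rewrite /continuous_at mulg1 => /(_ _ ksA).
  have [m [e e0 meA]] := F_emb _ A1.
  have val_cont : continuous (val : subgroup S -> Iso M) by exact: initial_continuous.
  have near_s : nbhs s [set t : subgroup S | mdist ((val s : Iso M) m) ((val t : Iso M) m) < e].
    exact: (val_cont s _ (Iso_eval_near (val s : Iso M) m e0)).
  apply: (@filterS _ (nbhs s) _ _ _ _ near_s) => t /= st.
  have -> : k t = (k s * ((k s)^-1 * k t))%g by rewrite mulgA mulgV mul1g.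
  by apply: meA; rewrite -F_dist !kP.
Qed.

(* A Urysohn space is infinite, so its weight is at least aleph_0, whereas the
   weight of a finite Hausdorff group is its order. For finite G the weight of M
   is therefore aleph_0, as in the convention that weights are infinite. *)
Theorem theorem1p7 (R : realType) (G : topologicalGroupType)
    (hG : hausdorff_space G) :
  exists M : metricType R,
    [/\ complete_metric M,
        omega_homogeneous M,
        Urysohn_metric M,
        (infinite_set [set: G] -> same_weight G M) /\
        (finite_set [set: G] -> has_weight M [set: nat]) &
        exists S : groupClosed (Iso M), topgroup_isomorphic G (subgroup S)].
Proof.
have [finG|infG] := pselect (finite_set [set: G]).
  (* The construction takes an infinite index type, so the open sets of the finite group are
     enumerated by [nat], with repetitions. *)
  have [base baseE] : exists base : nat -> set G, range base = [set U | open U].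
    have [f fP] : surjects nat (set G).
      apply: (card_le_surjects setT); apply: card_le_trans (countable_finite_subset (finite_set_countable finG)).
      by apply: subset_card_le => U _; split=> //; exact: sub_finite_set finG.
    exists (fun n => if pselect (open (f n)) then f n else setT).
    apply/seteqP; split=> [_ [n _ <-]|U oU]; first by case: pselect => //= _; exact: openT.
    by have [n fn] := fP U; exists n => //; rewrite fn; case: pselect.
  have baseP : basis (range base).
    rewrite baseE; split=> // x A.
    by rewrite nbhsE => -[U [oU Ux] UA]; exists U.
  have [M [Mc Mh MU [infM [u uP]] [F [F_morph F_cont F_emb]]]] :=
    @construction R G nat infinite_nat base baseP.
  exists M; split=> //; last exact: embedding_topgroup_isomorphic F_emb.
  split=> // _; have [B [BB Bnat]] := dense_basis infinite_nat uP.
  apply: has_weight_of_le BB Bnat _ => C BC; apply/infiniteP.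
  exact: infinite_basis (@metric_hausdorff _ _) BC infM.
(* A base of least cardinality serves as index type; it is infinite because [G] is infinite and
   Hausdorff. *)
have [K KB Kmin] := min_basis G.
have infK := infinite_basis hG KB infG.
have infJ : infinite_set [set: K].
  by move=> fK; apply: infK; apply: card_le_finite fK; exact: card_eqW (card_setT_sym K).
have rangeK : range (val : K -> set G) = K.
  apply/seteqP; split=> [_ [U _ <-]|U KU]; first exact: set_valP.
  by exists (SigSub (mem_set KU)).
have [|M [Mc Mh MU [infM [u uP]] [F [F_morph F_cont F_emb]]]] :=
  @construction R G K infJ val; first by rewrite rangeK.
exists M; split=> //; last exact: embedding_topgroup_isomorphic F_emb.
split=> // _; exists K; split.
  exact: has_weight_of_le KB (card_lexx K) Kmin.
have [B [BB BK]] := dense_basis infJ uP.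
apply: has_weight_of_le BB (card_le_trans BK (card_eqW (card_setT K))) _ => C BC.
have infC := infinite_basis (@metric_hausdorff _ _) BC infM.
(* Every base [C] of [M] yields a base of [G] that is no larger, so [M] cannot have smaller weight
   than [G]. *)
have [D [DB DC]] := basis_of_embedding F_morph F_cont F_emb infC BC.
exact: card_le_trans (Kmin _ DB) DC.
Qed.
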